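(* Let $L$ be a number field of degree $d$, with ring of integers $\mathcal{O}_L$, absolute discriminant $\operatorname{disc}(L)$, and let $t_L$ be the positive integer with $T_{L/\mathbb{Q}}(\mathcal{O}_L)=t_L\mathbb{Z}$. Consider the propositions: (A) $t_L\ge 2$; (B) there is a prime factor $p$ of $d$ such that $p^d$ divides $\operatorname{disc}(L)$; (C) $L$ is wild. Then (A) implies (B) and (B) implies (C). Moreover, (B) implies (A) when $d$ is prime or $d=4$; and if $L$ is normal over $\mathbb{Q}$, then (C) implies (A).
   Context: $T_{L/\mathbb{Q}}$ is the trace map $L\to\mathbb{Q}$ (sum of the $d$ complex embeddings); its image on $\mathcal{O}_L$ is $t_L\mathbb{Z}$ for a unique $t_L\in\mathbb{N}$, $t_L\geq1$. A prime $p$ is tamely ramified in $L$ if, writing $p\mathcal{O}_L=\wp_1^{e_1}\cdots\wp_s^{e_s}$ (distinct prime ideals), $p$ divides none of $e_1,\dots,e_s$; otherwise $p$ is wildly ramified in $L$. $L$ is tame if every prime is tamely ramified in $L$, and wild otherwise. *)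

(* Defs.v *)
From HB Require Import structures.
From mathcomp Require Import all_boot all_order all_algebra all_field.
Set Implicit Arguments. Unset Strict Implicit. Unset Printing Implicit Defensive.
Import GRing.Theory Num.Theory.
Local Open Scope ring_scope.

Section NumberField.
Variable L : fieldExtType rat.

Definition nf_degree : nat := \dim {:L}.

Definition integral (x : L) : Prop :=
  exists p : {poly int}, p \is monic /\ root (map_poly (fun z : int => z%:~R : L) p) x.

(* Trace T_{L/Q}(x): trace of the Q-linear map y |-> x*y, computed in the
   basis vbasis {:L}  (equal to the sum of the d complex embeddings). *)
Definition nf_trace (x : L) : rat :=
  \sum_(i < \dim {:L}) coord (vbasis {:L}) i (x * tnth (vbasis {:L}) i).

Definition is_trace_gen (t : nat) : Prop :=
  (0 < t)%N /\
  forall q : rat, (exists x : L, integral x /\ nf_trace x = q) <->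
                  (exists z : int, q = (z * t%:Z)%:~R).

Definition integral_basis (b : 'I_(\dim {:L}) -> L) : Prop :=
  (forall i, integral (b i)) /\
  (forall x : L, integral x <->
     exists c : 'I_(\dim {:L}) -> int, x = \sum_i (c i)%:~R * b i) /\
  (forall c : 'I_(\dim {:L}) -> int, \sum_i (c i)%:~R * b i = 0 -> forall i, c i = 0).

(* D is the (absolute) discriminant of L: det (T(b_i b_j)) for a Z-basis b
   of O_L (this value does not depend on the chosen Z-basis). *)
Definition is_disc (D : int) : Prop :=
  exists b, integral_basis b /\
    \det (\matrix_(i, j) nf_trace (b i * b j)) = D%:~R.

Definition OL_ideal (P : L -> Prop) : Prop :=
  (forall x, P x -> integral x) /\ P 0 /\
  (forall x y, P x -> P y -> P (x - y)) /\
  (forall a x, integral a -> P x -> P (a * x)).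

Definition OL_prime_ideal (P : L -> Prop) : Prop :=
  OL_ideal P /\ ~ P 1 /\
  (forall a b, integral a -> integral b -> P (a * b) -> P a \/ P b).

Fixpoint ideal_pow (P : L -> Prop) (e : nat) : L -> Prop :=
  match e with
  | 0 => integral
  | e'.+1 => fun x => exists s : seq (L * L),
      (forall pr, pr \in s -> ideal_pow P e' pr.1 /\ P pr.2) /\
      x = \sum_(pr <- s) pr.1 * pr.2
  end.

(* e = e_P(p), the exponent of the prime ideal P in p O_L:
   p O_L is contained in P^e but not in P^(e+1). *)
Definition ram_index (p : nat) (P : L -> Prop) (e : nat) : Prop :=
  ideal_pow P e (p%:R) /\ ~ ideal_pow P e.+1 (p%:R).

Definition wildly_ramified (p : nat) : Prop :=
  exists P e, OL_prime_ideal P /\ ram_index p P e /\ (0 < e)%N /\ (p %| e)%N.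

Definition wild : Prop := exists p, prime p /\ wildly_ramified p.

Definition normal_over_Q : Prop :=
  forall x : L, exists rs : seq L, minPoly 1%VS x = \prod_(r <- rs) ('X - r%:P).

Definition propA : Prop := exists t, is_trace_gen t /\ (2 <= t)%N.
Definition propB : Prop :=
  exists p D, prime p /\ (p %| nf_degree)%N /\ is_disc D /\ ((p ^ nf_degree)%:Z %| D)%Z.
Definition propC : Prop := wild.

End NumberField.

(* Main.v *)
(* Write R for the ring of integers and T for the trace. If p divides T(R), then p
   divides d = T(1) and every entry of the Gram matrix of an integral basis, so p^d
   divides the discriminant: this is A => B.

   Let P be a prime ideal over p and choose x outside R with xP contained in R. The
   ramification index e of P is the exponent such that h = p x^e lies in R but not in P;
   then h generates the P-component of R/pR, which is filtered by e copies of the residue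
   field. Hence T(hy) is, modulo p, e times a residue trace, and residue traces do not
   vanish identically: T(hR) lies in pZ if and only if p divides e.

   B => C: the Smith form of the Gram matrix gives either T(R) in pZ, or some w outside pR
   with T(wR) in p^2 Z. If P = (pR : rw) is an associated prime of w, then x = rw/p is
   admissible and s = xu, for some u in P, lies outside P while T(sR) is in pZ; thus p | e.

   d = p prime: e divides the rank of h on R/pR, so h is invertible modulo p and T(R) is in pZ.
   d = 4: otherwise h yields an idempotent u modulo 4 with T(uR) even and T(u) = 2 mod 4,
   and 16 | disc produces w outside 2R with T(wR) divisible by 8 (or enough such elements
   with 4); examining w^2 modulo 2 either contradicts T(u) = 2 mod 4 or makes w/2 integral.

   L normal: U = {y : T(yR) in pZ} is a Galois-stable ideal containing h. Take b = 1 - hr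
   in P. Its norm lies in P and in Z, hence in pZ and in U, and it is 1 modulo U. So 1 is
   in U. *)

Require Import Defs.
From Stdlib Require Classical_Prop.
From mathcomp Require Import all_boot all_order all_algebra all_fingroup all_field.
From mathcomp Require Import ring zify.
From HB Require Import structures.
Set Implicit Arguments. Unset Strict Implicit. Unset Printing Implicit Defensive.
Import Order.TTheory GRing.Theory Num.Theory.
Local Open Scope ring_scope.


(** * Traces on stable subspaces *)

Section TraceOn.
Variables (F : fieldType) (n : nat).

(** The matrix [pinvmx V *m V] projects onto the row space of [V]. For [V] stable under [Y] this is
    therefore the trace of the restriction of [Y], without a choice of basis. *)
Definition trace_on m (V : 'M[F]_(m, n)) (Y : 'M[F]_n) : F :=
  \tr (pinvmx V *m V *m Y).

Lemma proj_mxK m k (V : 'M[F]_(m, n)) (W : 'M[F]_(k, n)) :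
  (W <= V)%MS -> W *m (pinvmx V *m V) = W.
Proof. by move=> sWV; rewrite mulmxA mulmxKpV. Qed.

Lemma eq_trace_on m k (V : 'M[F]_(m, n)) (W : 'M[F]_(k, n)) (Y : 'M[F]_n) :
  (V :=: W)%MS -> (V *m Y <= V)%MS -> trace_on V Y = trace_on W Y.
Proof.
move=> eqVW sVY; rewrite /trace_on.
have sV : (pinvmx V *m V *m Y <= W)%MS.
  by rewrite -mulmxA -eqVW mulmx_sub.
have E : pinvmx W *m W *m (pinvmx V *m V *m Y) = pinvmx W *m W *m Y.
  by rewrite mulmxA -(mulmxA _ W) proj_mxK // eqVW.
by rewrite -{1}(proj_mxK sV) mxtrace_mulC E.
Qed.

Lemma trace_on0 m (Y : 'M[F]_n) : trace_on (0 : 'M[F]_(m, n)) Y = 0.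
Proof. by rewrite /trace_on mulmx0 mul0mx mxtrace0. Qed.

Lemma trace_on_range (V Y : 'M[F]_n) : (Y <= V)%MS -> trace_on V Y = \tr Y.
Proof.
by move=> sYV; rewrite /trace_on mxtrace_mulC proj_mxK.
Qed.

(** Additivity of the trace along the exact sequence formed by the kernel of [C] on [V], [V] itself
    and its image under [C]. The matrix [G] in the proof is a section of [C], which splits the
    restriction of [Y] into the two contributions. *)
Lemma trace_on_ker (V C Y : 'M[F]_n) : comm_mx C Y -> (V *m Y <= V)%MS ->
  trace_on V Y = trace_on (V *m C) Y + trace_on (V :&: kermx C)%MS Y.
Proof.
move=> cCY sVY; set V2 := (V :&: kermx C)%MS.
set G := pinvmx (V *m C) *m V.
have sVG k (W : 'M[F]_(k, n)) : (W <= V)%MS -> (W - W *m C *m G <= V2)%MS.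
  move=> sWV; rewrite sub_capmx addmx_sub ?eqmx_opp ?mulmx_sub ?submxMl //=.
  have sWC : (W *m C <= V *m C)%MS by apply: submxMr.
  apply/sub_kermxP; rewrite mulmxBl /G.
  by have /(canRL (subrK _)) := subrr (W *m C);
     rewrite -{1}(proj_mxK sWC) !mulmxA => ->; rewrite add0r subrr.
set X := pinvmx V *m V *m Y.
have sXV : (X <= V)%MS by rewrite /X -mulmxA mulmx_sub.
have sV2V : (V2 <= V)%MS by apply: capmxSl.
have V2C : V2 *m C = 0 by apply/sub_kermxP; apply: capmxSr.
have sV2Y : (V2 *m Y <= V2)%MS.
  rewrite sub_capmx (submx_trans _ sVY) ?submxMr //=.
  by apply/sub_kermxP; rewrite -mulmxA -cCY mulmxA V2C mul0mx.
have sGV : (G <= V)%MS by apply: submxMl.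
rewrite {1}/trace_on -/X -[X](subrK (X *m C *m G)) mxtraceD addrC; congr (_ + _).
  have EG : G *m X = G *m Y by rewrite /X mulmxA proj_mxK.
  by rewrite mxtrace_mulC mulmxA EG -mulmxA -cCY /G /trace_on !mulmxA.
have EX : pinvmx V2 *m V2 *m X = pinvmx V2 *m V2 *m Y.
  by rewrite /X mulmxA -(mulmxA _ V2) proj_mxK.
rewrite -(proj_mxK (sVG _ _ sXV)) mxtrace_mulC /trace_on.
rewrite mulmxBr EX (mulmxA _ (X *m C) G) (mulmxA _ X C) EX.
rewrite -(mulmxA _ Y C) -cCY mulmxA -(mulmxA _ V2 C) V2C.
by rewrite !(mulmx0, mul0mx) subr0.
Qed.
End TraceOn.


(** The polynomial X^q - X, with q = p^k, kills [N] and has derivative -1, so it is a product of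
    distinct linear factors. *)
Lemma Frobenius_diagonalizable (K : closedFieldType) p k n (N : 'M[K]_n) :
  p \in [pchar K] -> (0 < k)%N -> N ^+ (p ^ k) = N -> diagonalizable N.
Proof.
move=> pK k_gt0; case: n N => [|n] N NpN.
  by exists 1%:M; rewrite ?unitmx1 //; apply/is_diag_mxP => -[].
apply/diagonalizableP; pose q := (p ^ k)%N.
have q_gt1 : (1 < q)%N by rewrite -(exp1n k) ltn_exp2r ?prime_gt1 ?(pcharf_prime pK).
have [rs Drs] := closed_field_poly_normal ('X^q - 'X : {poly K}).
have lq : lead_coef ('X^q - 'X : {poly K}) = 1.
  by rewrite lead_coefDl ?lead_coefXn // size_polyN size_polyX size_polyXn.
rewrite lq scale1r in Drs; exists rs; last first.
  rewrite -Drs; apply: mxminpoly_min.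
  by rewrite rmorphB rmorphXn /= horner_mx_X NpN subrr.
rewrite -separable_prod_XsubC -Drs separable_poly.unlock derivB derivXn derivX.
rewrite -mulr_natr (_ : q%:R = 0) ?mulr0 ?sub0r; last first.
  apply/eqP; rewrite -polyC_natr polyC_eq0 -(dvdn_pcharf pK).
  by rewrite /q -(prednK k_gt0) expnS dvdn_mulr.
by rewrite coprimep_sym -scaleN1r coprimepZl ?oppr_eq0 ?oner_eq0 // coprime1p.
Qed.

(* Over an algebraic closure the [N i] become diagonal in a common basis; the rank
   hypothesis says that their diagonals span, so some combination of the [N i] is
   diagonal with trace 1. *)
Lemma trace_neq0 p m n (N : 'I_m -> 'M['F_p]_n) (w : 'rV['F_p]_n) (k : 'I_m -> nat) :
  prime p -> (0 < n)%N -> (forall i j, comm_mx (N i) (N j)) ->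
  (forall i, (0 < k i)%N /\ N i ^+ (p ^ k i) = N i) ->
  \rank (\matrix_i (w *m N i)) = n -> exists i, \tr (N i) != 0.
Proof.
move=> p_pr n_gt0 cN NpN rkN.
apply/existsP; apply: contraT; rewrite negb_exists => /forallP trN0.
have [K [iota _]] := countable_algebraic_closure 'F_p.
have pK : p \in [pchar K] by apply: (rmorph_pchar iota); apply: pchar_Fp.
pose NK i := map_mx iota (N i).
have [P Pu /allP /= dP] : codiagonalizable [seq NK i | i <- enum 'I_m].
  apply/codiagonalizableP; split=> [A B /mapP[i _ ->] /mapP[j _ ->]|A /mapP[i _ ->]].
    by rewrite /comm_mx /NK -!map_mxM cN.
  have [k_gt0 Ni] := NpN i; apply: (Frobenius_diagonalizable pK k_gt0).
  suff E e : NK i ^+ e = map_mx iota (N i ^+ e) by rewrite E Ni.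
  elim: e => [|e IH]; first by rewrite !expr0 map_mx1.
  by rewrite !exprS -[_ * _]/(_ *m _) IH -map_mxM.
pose D i := \row_j (P *m NK i *m invmx P) j j.
have dD i : NK i = invmx P *m diag_mx (D i) *m P.
  have NKi : NK i \in [seq NK i | i <- enum 'I_m] by rewrite map_f ?mem_enum.
  have /(diagonalizable_forP _ Pu) PNi := dP _ NKi.
  rewrite (_ : diag_mx (D i) = P *m NK i *m invmx P).
    by rewrite !mulmxA mulVmx // mul1mx mulmxKV.
  apply/matrixP => a b; rewrite [LHS]mxE; case: eqVneq => [->|ne_ab] /=.
    by rewrite mxE.
  by rewrite PNi.
pose v := map_mx iota w *m invmx P; pose Del := \matrix_(i, j) D i 0 j.
(* Over [K], row i of the matrix in the rank hypothesis is row i of [Del] times the fixed matrix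
   [diag_mx v *m P], so [Del] has rank n. *)
have rDel : row_full Del.
  rewrite -col_leq_rank -{1}rkN -(mxrank_map iota).
  rewrite (_ : map_mx iota _ = Del *m (diag_mx v *m P)) ?mxrankM_maxl //.
  rewrite mulmxA; apply/row_matrixP => i; rewrite row_mul -map_row rowK map_mxM.
  rewrite -/(NK i) dD !mulmxA -/v; congr (_ *m P); apply/rowP => j.
  by rewrite !mul_mx_diag !mxE mulrC.
have /row_fullP[B BDel] := rDel.
pose j0 := Ordinal n_gt0.
have : \sum_j (B *m Del) j0 j = 1.
  rewrite BDel (bigD1 j0) //= big1 ?mxE ?eqxx ?addr0 // => j /negPf.
  by rewrite mxE eq_sym => ->.
under eq_bigr => j _ do rewrite mxE.
rewrite exchange_big /= big1 => [|i _]; first by move/esym/eqP; rewrite oner_eq0.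
rewrite -mulr_sumr (_ : \sum_j Del i j = \tr (NK i)); last first.
  rewrite dD mxtrace_mulC mulmxA mulmxV // mul1mx mxtrace_diag.
  by apply: eq_bigr => j _; rewrite mxE.
by rewrite trace_map_mx (eqP (negbNE (trN0 i))) rmorph0 mulr0.
Qed.

(** Expressing the restrictions in a basis of [V] reduces this to [trace_neq0]. It will serve with
    [V] the last layer of the component of R/pR at a prime ideal, generated by [z], where it says
    that residue traces do not all vanish. *)
Lemma trace_on_neq0 p m n (Y : 'I_m -> 'M['F_p]_n) (z : 'rV['F_p]_n) (k : 'I_m -> nat)
    (V := \matrix_i (z *m Y i)) :
  prime p -> V != 0 -> (z <= V)%MS -> (forall i j, comm_mx (Y i) (Y j)) ->
  (forall i, (V *m Y i <= V)%MS) ->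
  (forall i, (0 < k i)%N /\ V *m (Y i ^+ (p ^ k i)) = V *m Y i) ->
  exists i, trace_on V (Y i) != 0.
Proof.
move=> p_pr V_neq0 zV cY sY YpY.
have [B eqBV freeB] : exists2 B : 'M_(\rank V, n), (B :=: V)%MS & row_free B.
  by exists (row_base V); [apply: eq_row_base | apply: row_base_free].
have sBY i : (B *m Y i <= B)%MS by rewrite eqBV (eqmxMr _ eqBV).
have [N BN trN] : exists2 N : 'I_m -> 'M_(\rank V),
    forall i, N i *m B = B *m Y i & forall i, \tr (N i) = trace_on V (Y i).
  exists (fun i => B *m Y i *m pinvmx B) => i; first by rewrite mulmxKpV.
  by rewrite mxtrace_mulC mulmxA; apply: eq_trace_on.
have BNX i e : N i ^+ e *m B = B *m (Y i ^+ e).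
  elim: e => [|e IH]; first by rewrite !expr0 mul1mx mulmx1.
  rewrite !exprS -[N i * _]/(N i *m _) -[Y i * _]/(Y i *m _).
  by rewrite (mulmxA B) -BN -!(mulmxA (N i)) IH.
have [w Dw] : exists w, z = w *m B by apply/submxP; rewrite eqBV.
have := @trace_neq0 p m _ N w k p_pr; rewrite lt0n mxrank_eq0 => /(_ V_neq0) [].
- move=> i j; apply: (row_free_inj freeB); rewrite -!mulmxA !BN.
  by rewrite !mulmxA !BN -!mulmxA cY.
- move=> i; have [k_gt0 E] := YpY i; split=> //.
  apply: (row_free_inj freeB); rewrite BNX BN.
  have /submxP[D ->] : (B <= V)%MS by rewrite eqBV.
  by rewrite -!mulmxA E.
- have -> : \matrix_i (w *m N i) = V *m pinvmx B.
    apply/row_matrixP => i; rewrite row_mul !rowK Dw -(mulmxA w) -BN mulmxA.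
    by rewrite -(mulmxA _ B) mulmxVp // mulmx1.
  apply/eqP; rewrite eqn_leq rank_leq_col /=.
  have /mxrankS : (V <= V *m pinvmx B *m B)%MS by rewrite mulmxKpV // eqBV.
  by move=> /leq_trans; apply; apply: mxrankM_maxl.
by move=> i; rewrite trN => tr_neq0; exists i.
Qed.


(** * Integral elements and lattices *)

Section Field.
Variable L : fieldExtType rat.
Local Notation d := (\dim {:L}).
Implicit Types (x y z : L) (w : 'I_d -> L).

Lemma integralE x : integral x <-> integralOver (intr : int -> L) x.
Proof. by split=> [[q [mq rq]]|[q mq rq]]; exists q. Qed.

Lemma integral_int (n : int) : integral (n%:~R : L).
Proof. by apply/integralE; apply: integral_id. Qed.

Lemma integralN n : integral (n%:R : L).
Proof. by apply/integralE; apply: integral_nat. Qed.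

Lemma integralD x y : integral x -> integral y -> integral (x + y).
Proof. by rewrite !integralE; apply: integral_add. Qed.

Lemma integralB x y : integral x -> integral y -> integral (x - y).
Proof. by rewrite !integralE; apply: integral_sub. Qed.

Lemma integralM x y : integral x -> integral y -> integral (x * y).
Proof. by rewrite !integralE; apply: integral_mul. Qed.

Lemma integral_1 : integral (1 : L). Proof. exact: (integralN 1). Qed.
Lemma integral_0 : integral (0 : L). Proof. exact: (integralN 0). Qed.

Lemma integralX x n : integral x -> integral (x ^+ n).
Proof.
move=> ix; elim: n => [|n IH]; first by rewrite expr0; apply: integral_1.
by rewrite exprS; apply: integralM.
Qed.

Lemma integral_sum (I : Type) (r : seq I) (P : pred I) (F : I -> L) :
  (forall i, P i -> integral (F i)) -> integral (\sum_(i <- r | P i) F i).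
Proof.
move=> iF; apply: big_ind => //; [exact: integral_0 | exact: integralD].
Qed.

(** An eigenvalue of an integer matrix is a root of its monic characteristic polynomial. The
    transpose appears because [eigenvalue] refers to row vectors. *)
Lemma integral_eigen n (g : 'cV[L]_n) (A : 'M[int]_n) x :
  g != 0 -> x *: g = map_mx intr A *m g -> integral x.
Proof.
move=> g_neq0 xg; exists (char_poly A^T); split; first exact: char_poly_monic.
rewrite -[map_poly _ _]/(map_poly (intr : {rmorphism int -> L}) _) map_char_poly.
rewrite -eigenvalue_root_char; apply/eigenvalueP; exists g^T.
  by rewrite -map_trmx -trmx_mul -xg linearZ.
by rewrite -(inj_eq (@trmx_inj _ _ _)) trmxK trmx0.
Qed.

Definition coords x : 'rV[rat]_d := \row_i coord (vbasis {:L}) i x.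
Local Notation vb i := (tnth (vbasis {:L}) i).

Lemma coordsE x : x = \sum_i coords x 0 i *: vb i.
Proof.
rewrite {1}(coord_vbasis (memvf x)); apply: eq_bigr => i _.
by rewrite mxE (tnth_nth 0).
Qed.

Lemma coords_sum (a : 'rV[rat]_d) : coords (\sum_i a 0 i *: vb i) = a.
Proof.
apply/rowP => i; rewrite mxE.
under eq_bigr => j _ do rewrite (tnth_nth 0).
by rewrite coord_sum_free // (basis_free (vbasisP _)).
Qed.

Lemma coords_inj : injective coords.
Proof. by move=> x y E; rewrite (coordsE x) E -coordsE. Qed.

Lemma coordsD x y : coords (x + y) = coords x + coords y.
Proof. by apply/rowP => i; rewrite !mxE linearD. Qed.
Lemma coordsZ a x : coords (a *: x) = a *: coords x.
Proof. by apply/rowP => i; rewrite !mxE linearZ. Qed.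
Lemma coords0 : coords 0 = 0.
Proof. by apply/rowP => i; rewrite !mxE linear0. Qed.
Lemma coords_lin (I : Type) (r : seq I) (a : I -> rat) (u : I -> L) :
  coords (\sum_(i <- r) a i *: u i) = \sum_(i <- r) a i *: coords (u i).
Proof.
elim: r => [|i r IH]; first by rewrite !big_nil coords0.
by rewrite !big_cons coordsD coordsZ IH.
Qed.

Definition mulmat x : 'M[rat]_d := \matrix_i coords (x * vb i).

Lemma coordsM x y : coords (x * y) = coords y *m mulmat x.
Proof.
rewrite {1}(coordsE y) mulr_sumr mulmx_sum_row.
under eq_bigr => i _ do rewrite -scalerAr.
by rewrite coords_lin; apply: eq_bigr => i _; rewrite rowK.
Qed.

Lemma mulmatM x y : mulmat (x * y) = mulmat x *m mulmat y.
Proof.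
apply/row_matrixP => i; rewrite row_mul !rowK -coordsM; congr coords.
by rewrite mulrCA mulrA.
Qed.

Lemma mulmatD x y : mulmat (x + y) = mulmat x + mulmat y.
Proof. by apply/row_matrixP => i; rewrite linearD /= !rowK mulrDl coordsD. Qed.

Lemma mulmatZ a x : mulmat (a *: x) = a *: mulmat x.
Proof. by apply/row_matrixP => i; rewrite linearZ /= !rowK -scalerAl coordsZ. Qed.

Lemma mulmat1 : mulmat 1 = 1%:M.
Proof.
apply/row_matrixP => i; rewrite rowK mul1r row1.
rewrite -(coords_sum (delta_mx 0 i)); congr coords.
rewrite (bigD1 i) //= mxE !eqxx scale1r big1 ?addr0 // => j /negPf ne.
by rewrite mxE ne andbF scale0r.
Qed.

Lemma nf_traceE x : nf_trace x = \tr (mulmat x).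
Proof. by apply: eq_bigr => i _; rewrite !mxE. Qed.

Lemma nf_traceD x y : nf_trace (x + y) = nf_trace x + nf_trace y.
Proof. by rewrite !nf_traceE mulmatD mxtraceD. Qed.

Lemma nf_traceZ a x : nf_trace (a *: x) = a * nf_trace x.
Proof. by rewrite !nf_traceE mulmatZ mxtraceZ. Qed.

Lemma nf_trace1 : nf_trace (1 : L) = d%:R.
Proof. by rewrite nf_traceE mulmat1 mxtrace1. Qed.

Lemma intr_scale (c : int) : (c%:~R : L) = (c%:~R : rat) *: 1.
Proof. by rewrite scaler_int. Qed.

Lemma intrM_scale (c : int) x : c%:~R * x = (c%:~R : rat) *: x.
Proof. by rewrite intr_scale -scalerAl mul1r. Qed.

Lemma dim_gt0 : (0 < d)%N.
Proof. by rewrite lt0n dimv_eq0 -subv0; apply/negP => /subvP/(_ _ (memvf 1));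
  rewrite memv0 oner_eq0. Qed.

(** Over [algC] the trace is the sum of the eigenvalues of multiplication by [x]. Each is a root of
    the monic polynomial of [x], hence an algebraic integer, and a rational algebraic integer is an
    integer. *)
Lemma nf_trace_int x : integral x -> nf_trace x \is a Num.int.
Proof.
case=> q [q_monic /rootP qx].
pose A : 'M[algC]_d := map_mx ratr (mulmat x).
have [rs Drs] := closed_field_poly_normal (char_poly A).
rewrite (monicP (char_poly_monic A)) scale1r in Drs.
have rs_int r : r \in rs -> r \in Aint.
  move=> rs_r; have : root (char_poly A) r by rewrite Drs root_prod_XsubC.
  rewrite -eigenvalue_root_char => /eigenvalueP[v vA v_neq0].
  have vq (u : {poly int}) : v *m map_mx ratr (mulmat (map_poly intr u).[x])
      = (map_poly intr u).[r] *: v.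
    elim/poly_ind: u => [|u c IH].
      rewrite !rmorph0 !horner0 scale0r -[0 : L](scale0r 1) mulmatZ scale0r.
      by rewrite map_mx0 mulmx0.
    rewrite !rmorphD !rmorphM /= !map_polyX !map_polyC /= !hornerE.
    rewrite mulmatD mulmatM map_mxD map_mxM mulmxDr mulmxA IH scalerDl.
    congr (_ + _); first by rewrite -scalemxAl vA scalerA.
    rewrite intr_scale mulmatZ mulmat1 map_mxZ map_mx1 -scalemxAr mulmx1.
    by rewrite rmorph_int.
  have := vq q; rewrite qx -[0 : L](scale0r 1) mulmatZ scale0r map_mx0 mulmx0.
  move/esym/eqP; rewrite scaler_eq0 (negPf v_neq0) orbF => qr.
  apply: (@root_monic_Aint (map_poly intr q)) qr _ _; first exact: monic_map.
  by apply/polyOverP => i; rewrite coef_map intr_int.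
have size_rs : size rs = d.
  by apply: succn_inj; rewrite -(size_char_poly A) Drs size_prod_XsubC.
have trA : \tr A = \sum_(r <- rs) r.
  apply: oppr_inj; rewrite -char_poly_trace ?dim_gt0 // Drs -size_rs.
  by rewrite coefPn_prod_XsubC // size_rs -lt0n dim_gt0.
rewrite -Cint_rat; apply: Cint_rat_Aint; first exact: Crat_rat.
rewrite nf_traceE -trace_map_mx trA big_seq.
by apply: rpred_sum => r; apply: rs_int.
Qed.

End Field.


(** * Lattices, the trace form and existence of integral bases *)

Lemma clear_denominators m n (A : 'M[rat]_(m, n)) :
  exists2 N : int, N != 0 & exists B : 'M[int]_(m, n), N%:~R *: A = map_mx intr B.
Proof.
pose N : int := \prod_(k : 'I_m * 'I_n) denq (A k.1 k.2).
exists N; first by apply/prodf_neq0 => k _; apply: denq_neq0.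
exists (\matrix_(i, j) numq (N%:~R * A i j)); apply/matrixP => i j.
rewrite !mxE numqK // /N (bigD1 (i, j)) //= rmorphM /= mulrAC mulrC.
by rewrite rpredM ?intr_int // mulrC -numqE intr_int.
Qed.

Lemma det_replace_row (R : comPzRingType) n (k : 'I_n) (r : 'rV[R]_n) :
  \det (\matrix_i (if i == k then r else delta_mx 0 i)) = r 0 k.
Proof.
set E := \matrix_i _; have cofE j : cofactor E k j = cofactor 1%:M k j.
  congr (_ * _); congr (\det _); apply/matrixP => a b; rewrite !mxE.
  by rewrite [lift k a == k]eq_sym (negPf (neq_lift _ _)) mxE eqxx eq_sym.
rewrite (expand_det_row E k); under eq_bigr => j _ do rewrite cofE.
have := mul_mx_adj (1%:M : 'M[R]_n); rewrite mul1mx det1 => /matrixP adj1.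
rewrite (bigD1 k) //= big1 => [|j ne_jk]; last first.
  by have := adj1 j k; rewrite !mxE (negPf ne_jk) => ->; rewrite mulr0.
by have := adj1 k k; rewrite !mxE eqxx => ->; rewrite mulr1 addr0.
Qed.

Section Lattice.
Variable L : fieldExtType rat.
Local Notation d := (\dim {:L}).
Local Notation vb i := (tnth (vbasis {:L}) i).
Implicit Types (x y z : L) (b w : 'I_d -> L).

Lemma scale_integral x : exists2 N : int, N != 0 & integral (N%:~R * x).
Proof.
have [N N_neq0 [B DB]] := clear_denominators (mulmat x); exists N => //.
apply: (@integral_eigen L d (\col_i vb i) B).
  apply/negP => /eqP /colP v0; have := oner_neq0 L; rewrite (coordsE 1).
  by rewrite big1 ?eqxx // => i _; have := v0 i; rewrite !mxE => ->; rewrite scaler0.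
apply/colP => i; rewrite !mxE -mulrA [x * _]coordsE mulr_sumr.
apply: eq_bigr => j _; rewrite intrM_scale scalerA !mxE.
by have /matrixP/(_ i j) := DB; rewrite !mxE => ->; rewrite intrM_scale.
Qed.

Definition coordmx b : 'M[rat]_d := \matrix_i coords (b i).
Definition gram b : 'M[rat]_d := \matrix_(i, j) nf_trace (b i * b j).

Lemma nf_trace_lin (I : Type) (r : seq I) (a : I -> rat) (u : I -> L) :
  nf_trace (\sum_(i <- r) a i *: u i) = \sum_(i <- r) a i * nf_trace (u i).
Proof.
elim: r => [|i r IH]; first by rewrite !big_nil -(scale0r 0) nf_traceZ mul0r.
by rewrite !big_cons nf_traceD nf_traceZ IH.
Qed.

Lemma gram_change b b' (S : 'M[rat]_d) :
  (forall i, b' i = \sum_j S i j *: b j) -> gram b' = S *m gram b *m S^T.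
Proof.
move=> Db; apply/matrixP => i j; rewrite !mxE (Db j) mulr_sumr.
under eq_bigr => k _ do rewrite -scalerAr.
rewrite nf_trace_lin; apply: eq_bigr => k _; rewrite !mxE mulrC; congr (_ * _).
rewrite Db mulr_suml; under eq_bigr => l _ do rewrite -scalerAl.
by rewrite nf_trace_lin; apply: eq_bigr => l _; rewrite !mxE.
Qed.

Lemma gram_coordmx b :
  gram b = coordmx b *m gram (tnth (vbasis {:L})) *m (coordmx b)^T.
Proof.
by apply: gram_change => i; rewrite {1}(coordsE (b i)); apply: eq_bigr => j _;
  rewrite [coordmx b i j]mxE.
Qed.

(** The trace form is nondegenerate: for y nonzero the trace of y y^-1 = 1 is the degree, which is
    nonzero in characteristic 0. *)
Lemma gram_vbasis_unit : gram (tnth (vbasis {:L})) \in unitmx.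
Proof.
rewrite -row_free_unit; apply: inj_row_free => v vG0.
rewrite -(coords_sum v) -(coords0 L); congr coords; set y := \sum_i _.
apply/eqP; apply: contraT => y_neq0.
have Ty j : nf_trace (y * vb j) = 0.
  rewrite /y mulr_suml; under eq_bigr => i _ do rewrite -scalerAl.
  rewrite nf_trace_lin; have /rowP/(_ j) := vG0; rewrite !mxE => E; rewrite -[RHS]E.
  by apply: eq_bigr => i _; rewrite !mxE.
have : nf_trace (y * y^-1) = 0.
  rewrite (coordsE y^-1) mulr_sumr; under eq_bigr => j _ do rewrite -scalerAr.
  by rewrite nf_trace_lin big1 // => j _; rewrite Ty mulr0.
rewrite divff // nf_trace1 => /eqP; rewrite pnatr_eq0.
by rewrite -leqn0 leqNgt dim_gt0.
Qed.

Lemma gram_unit b : (\det (gram b) != 0) = (coordmx b \in unitmx).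
Proof.
rewrite gram_coordmx !det_mulmx det_tr !mulf_eq0 !negb_or -!unitfE -!unitmxE.
by rewrite gram_vbasis_unit andbT andbb.
Qed.

Definition qcoords b x : 'rV[rat]_d := coords x *m invmx (coordmx b).

Lemma qcoordsE b x : coordmx b \in unitmx -> x = \sum_i qcoords b x 0 i *: b i.
Proof.
move=> bU; apply: coords_inj; rewrite coords_lin -[LHS](mulmxKV bU) mulmx_sum_row.
by apply: eq_bigr => i _; rewrite rowK.
Qed.

Lemma qcoords_sum b (c : 'rV[rat]_d) : coordmx b \in unitmx ->
  qcoords b (\sum_i c 0 i *: b i) = c.
Proof.
move=> bU; rewrite /qcoords coords_lin -[RHS](mulmxK bU) (mulmx_sum_row c); congr (_ *m _).
by apply: eq_bigr => i _; rewrite rowK.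
Qed.

(* A Q-basis in [N] whose Gram determinant is minimal in absolute value is a Z-basis:
   reducing a non-integral coordinate modulo 1 would shrink the determinant. *)
Lemma lattice_basis (N : L -> Prop) e :
  (forall x y, N x -> N y -> N (x - y)) -> (forall x, N x -> integral x) ->
  (forall i, N (e i)) -> coordmx e \in unitmx ->
  exists b, [/\ forall i, N (b i), coordmx b \in unitmx
    & forall x, N x -> exists c : 'I_d -> int, x = \sum_i (c i)%:~R * b i].
Proof.
move=> NB Nint Ne eU.
have N0 : N 0 by rewrite -(subrr (e (Ordinal (dim_gt0 L)))); apply: NB.
have NN x : N x -> N (- x) by rewrite -[- x]add0r; apply: NB.
have ND x y : N x -> N y -> N (x + y) by move=> Nx Ny; rewrite -[y]opprK; apply/NB/NN.
have NZ (m : int) x : N x -> N (m%:~R * x).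
  move=> Nx; have NZn n : N (n%:R * x).
    by elim: n => [|n IH]; rewrite ?mul0r // -natr1 mulrDl mul1r; apply: ND.
  by case: m => n; [apply: NZn | rewrite NegzE mulrNz mulNr; apply/NN/NZn].
have gint b : (forall i, N (b i)) -> \det (gram b) \is a Num.int.
  move=> Nb; rewrite /determinant.
  apply: rpred_sum => s _; rewrite rpredMsign; apply: rpred_prod => i _.
  by rewrite mxE nf_trace_int //; apply: integralM; apply: Nint.
(* By [gint] the Gram determinant is an integer, so [numq] loses nothing and the descent on its
   absolute value stops. *)
move: {2}_.+1 (ltnSn (absz (numq (\det (gram e))))) => n.
elim: n e Ne eU => // n IH b Nb bU; rewrite ltnS => le_n.
have [good|bad] := Classical_Prop.classic (forall x, N x -> forall i, qcoords b x 0 i \is a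
  Num.int).
  exists b; split=> // x Nx; exists (fun i => numq (qcoords b x 0 i)).
  rewrite {1}(qcoordsE x bU); apply: eq_bigr => i _.
  by rewrite intrM_scale numqK // good.
have [x Nx [k xk]] : exists2 x, N x & exists k, qcoords b x 0 k \isn't a Num.int.
  apply: Classical_Prop.NNPP => none; apply: bad => x Nx k.
  by apply: contraT => xk; case: none; exists x => //; exists k.
pose fl := Num.floor (qcoords b x 0 k); pose y := x - fl%:~R * b k.
have Ny : N y by apply: NB => //; apply: NZ.
pose b' i := if i == k then y else b i.
pose r := qcoords b y.
have rk : r 0 k = qcoords b x 0 k - fl%:~R.
  rewrite /r /y {1}(qcoordsE x bU) intrM_scale.
  pose c := qcoords b x - fl%:~R *: delta_mx 0 k : 'rV[rat]_d.
  rewrite (_ : _ - _ = \sum_i c 0 i *: b i) ?(qcoords_sum _ bU).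
    by rewrite !mxE !eqxx mulr1.
  rewrite [RHS](bigD1 k) // [in LHS](bigD1 k) //= !mxE !eqxx mulr1 scalerBl addrAC.
  congr (_ + _); apply: eq_bigr => j /negPf nejk.
  by rewrite !mxE nejk andbF mulr0 subr0.
have Db' i : b' i = \sum_j (\matrix_i (if i == k then r else delta_mx 0 i)) i j *: b j.
  rewrite /b'; under eq_bigr => j _ do rewrite mxE.
  case: eqP => [_|_]; first by rewrite {1}(qcoordsE y bU).
  rewrite (bigD1 i) //= mxE !eqxx scale1r big1 ?addr0 // => j /negPf neji.
  by rewrite mxE neji andbF scale0r.
have gb' : \det (gram b') = r 0 k ^+ 2 * \det (gram b).
  by rewrite (gram_change Db') !det_mulmx det_tr det_replace_row mulrAC expr2.
have /andP[r_ge0 r_lt1] : 0 <= r 0 k < 1.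
  by rewrite rk subr_ge0 floor_le ltrBlDl -[1]/(1%:~R) -intrD floorD1_gt.
have r_neq0 : r 0 k != 0.
  by apply: contraNneq xk => /eqP; rewrite rk subr_eq0 => /eqP ->; apply: intr_int.
have Nb' i : N (b' i) by rewrite /b'; case: ifP.
have gb_neq0 : \det (gram b) != 0 by rewrite gram_unit.
apply: (IH b') => //; first by rewrite -gram_unit gb' mulf_neq0 // expf_neq0.
apply: leq_trans le_n.
have absE (q : rat) : q \is a Num.int -> (absz (numq q))%:R = `|q|.
  by move=> /numqK {2}<-; rewrite -intr_norm natr_absz.
rewrite -(ltr_nat rat) !absE ?gint // gb' normrM gtr_pMl ?normr_gt0 //.
by rewrite normrX ger0_norm // expr_lt1.
Qed.

Lemma scaled_vbasis y : y != 0 -> exists e, coordmx e \in unitmx /\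
  forall i, exists2 u, integral u & e i = y * u.
Proof.
move=> y_neq0.
have [M M_neq0 MvB] : exists2 M : int, M != 0 & forall i, integral (M%:~R * vb i).
  have [f f0 fP] := fin_all_exists2 (fun i => scale_integral (vb i)).
  exists (\prod_i f i); first by apply/prodf_neq0.
  move=> i; rewrite (bigD1 i) //= rmorphM mulrAC mulrC /=.
  by apply: integralM => //; apply: integral_int.
pose e i := y * (M%:~R * vb i); exists e; split; last by move=> i; exists (M%:~R * vb i).
rewrite -row_free_unit; apply: inj_row_free => v ve0.
have ve : \sum_i v 0 i *: e i = 0.
  apply: coords_inj; rewrite coords0 coords_lin; move: ve0.
  rewrite mulmx_sum_row => E; rewrite -[RHS]E.
  by apply: eq_bigr => i _; rewrite rowK.
have : (y * M%:~R) * (\sum_i v 0 i *: vb i) = 0.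
  by rewrite mulr_sumr -[RHS]ve; apply: eq_bigr => i _; rewrite -scalerAr /e mulrA.
have M_neq0' : (M%:~R : L) != 0 by rewrite intr_scale scaler_eq0 intr_eq0 oner_eq0 orbF.
move/eqP; rewrite !mulf_eq0 (negPf M_neq0') (negPf y_neq0) /= => /eqP v0.
by rewrite -(coords_sum v) v0 coords0.
Qed.

(** The z for which all z x^n are integral form a lattice of full rank, since it contains the
    multiples of [y] by integral elements. It is stable under [x], so [x] acts on a Z-basis of it by
    an integer matrix. *)
Lemma integral_almost x y : y != 0 -> (forall n, integral (y * x ^+ n)) -> integral x.
Proof.
move=> y_neq0 yx; pose N z := forall n, integral (z * x ^+ n).
have [e [eU eE]] := scaled_vbasis y_neq0.
have Ne i : N (e i) by move=> n; have [u iu ->] := eE i; rewrite mulrAC; apply: integralM.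
have [||b [Nb bU bN]] := lattice_basis (N := N) _ _ Ne eU.
- by move=> u v Nu Nv n; rewrite mulrBl; apply: integralB.
- by move=> z /(_ 0%N); rewrite mulr1.
have xb i : exists c : 'I_d -> int, x * b i = \sum_j (c j)%:~R * b j.
  by apply: bN => n; rewrite [x * _]mulrC -mulrA -exprS; apply: Nb.
have [c xbc] := fin_all_exists xb.
apply: (@integral_eigen L d (\col_i b i) (\matrix_(i, j) c i j)).
  apply/negP => /eqP /colP b0; have := oner_neq0 L; rewrite {1}(qcoordsE 1 bU).
  by rewrite big1 ?eqxx // => i _; have := b0 i; rewrite !mxE => ->; rewrite scaler0.
apply/colP => i; rewrite !mxE xbc; apply: eq_bigr => j _; by rewrite !mxE.
Qed.

Lemma integral_basis_exists : exists b, @integral_basis L b.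
Proof.
have [e [eU eE]] := scaled_vbasis (oner_neq0 L).
have [||||b [ib bU bI]] := lattice_basis (N := @integral L) (e := e).
- exact: integralB.
- by [].
- by move=> i; have [u iu ->] := eE i; rewrite mul1r.
- by [].
exists b; split=> //; split.
  move=> x; split; first exact: bI.
  by case=> c ->; apply: integral_sum => i _; apply: integralM => //; apply: integral_int.
move=> c c0 i; have := qcoords_sum (\row_i (c i)%:~R) bU.
rewrite (_ : \sum_i _ = 0).
  by rewrite /qcoords coords0 mul0mx => /rowP/(_ i); rewrite !mxE => /esym/eqP;
    rewrite intr_eq0 => /eqP.
by rewrite -[RHS]c0; apply: eq_bigr => j _; rewrite mxE intrM_scale.
Qed.

Lemma integral_basis_unit b : integral_basis b -> coordmx b \in unitmx.
Proof.
case=> _ [_ bfree]; rewrite -row_free_unit; apply: inj_row_free => v vb0.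
have [N N_neq0 [c Nv]] := clear_denominators v.
have c0 i : c 0 i = 0.
  apply: (bfree (fun i => c 0 i)).
  have : \sum_i (N%:~R *: v) 0 i *: b i = 0.
    apply: coords_inj; rewrite coords_lin coords0.
    have : N%:~R *: v *m coordmx b = 0 by rewrite -scalemxAl vb0 scaler0.
    rewrite mulmx_sum_row => E; rewrite -[RHS]E.
    by apply: eq_bigr => j _; rewrite rowK.
  rewrite Nv => E; rewrite -[RHS]E; apply: eq_bigr => j _.
  by rewrite mxE intrM_scale.
apply/rowP => i; have /rowP/(_ i) := Nv; rewrite !mxE c0 => /eqP.
by rewrite mulf_eq0 intr_eq0 (negPf N_neq0) => /eqP.
Qed.

End Lattice.


(** * Integer coordinates and integer multiplication matrices in an integral basis *)

Section Coordinates.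
Variables (L : fieldExtType rat) (b : 'I_(\dim {:L}) -> L).
Hypothesis bI : integral_basis b.
Local Notation d := (\dim {:L}).
Implicit Types (x y z : L).

Let bU : coordmx b \in unitmx := integral_basis_unit bI.

Lemma integral_basisP i : integral (b i). Proof. by case: bI. Qed.

Lemma natL_neq0 n : (0 < n)%N -> (n%:R : L) != 0.
Proof. by move=> n_gt0; rewrite -scaler_nat scaler_eq0 oner_eq0 orbF pnatr_eq0 -lt0n. Qed.

(** For integral [x] the rational coordinates are integers and [numq] is exact; for other [x] the
    value carries no meaning. *)
Definition icoords x : 'rV[int]_d := \row_i numq (qcoords b x 0 i).

Lemma icoords_sum (c : 'I_d -> int) : icoords (\sum_i (c i)%:~R * b i) = \row_i c i.
Proof.
have E : \sum_i (c i)%:~R * b i = \sum_i (\row_i (c i)%:~R : 'rV[rat]_d) 0 i *: b i.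
  by apply: eq_bigr => i _; rewrite mxE intrM_scale.
by apply/rowP => i; rewrite [LHS]mxE [RHS]mxE E qcoords_sum // mxE numq_int.
Qed.

Lemma icoordsE x : integral x -> x = \sum_i (icoords x 0 i)%:~R * b i.
Proof.
case: bI => _ [bE _] /bE [c ->]; rewrite icoords_sum.
by apply: eq_bigr => i _; rewrite mxE.
Qed.

Lemma icoords_inj x y : integral x -> integral y -> icoords x = icoords y -> x = y.
Proof. by move=> ix iy E; rewrite (icoordsE ix) E -icoordsE. Qed.

Lemma integral_comb (c : 'I_d -> int) : integral (\sum_i (c i)%:~R * b i).
Proof.
apply: integral_sum => i _; apply: integralM (integral_int _ _) _.
exact: integral_basisP.
Qed.

Lemma icoordsD x y : integral x -> integral y -> icoords (x + y) = icoords x + icoords y.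
Proof.
move=> ix iy; rewrite {1}(icoordsE ix) {1}(icoordsE iy) -big_split /=.
rewrite (eq_bigr (fun i => (icoords x 0 i + icoords y 0 i)%:~R * b i)).
  by rewrite icoords_sum; apply/rowP => i; rewrite !mxE.
by move=> i _; rewrite intrD mulrDl.
Qed.

Lemma icoordsZ (n : int) x : integral x -> icoords (n%:~R * x) = n *: icoords x.
Proof.
move=> ix; rewrite {1}(icoordsE ix) mulr_sumr.
rewrite (eq_bigr (fun i => (n * icoords x 0 i)%:~R * b i)).
  by rewrite icoords_sum; apply/rowP => i; rewrite !mxE.
by move=> i _; rewrite intrM mulrA.
Qed.

Lemma icoords_lin (I : Type) (r : seq I) (a : I -> int) (u : I -> L) :
  (forall i, integral (u i)) ->
  icoords (\sum_(i <- r) (a i)%:~R * u i) = \sum_(i <- r) a i *: icoords (u i).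
Proof.
move=> iu; elim: r => [|i r IH].
  by rewrite !big_nil; have := icoordsZ 0 (integral_1 L); rewrite mul0r scale0r.
rewrite !big_cons icoordsD ?icoordsZ ?IH //.
  by apply: integralM => //; apply: integral_int.
by apply: integral_sum => j _; apply: integralM => //; apply: integral_int.
Qed.

Lemma icoords_b i : icoords (b i) = delta_mx 0 i.
Proof.
have -> : b i = \sum_j ((i == j)%:Z)%:~R * b j.
  by rewrite (bigD1 i) //= eqxx mul1r big1 ?addr0 // => j /negPf; rewrite eq_sym => ->;
    rewrite mul0r.
by rewrite icoords_sum; apply/rowP => j; rewrite !mxE eqxx eq_sym; case: eqP.
Qed.

Definition imat x : 'M[int]_d := \matrix_i icoords (x * b i).

Lemma icoordsM x y : integral x -> integral y -> icoords (x * y) = icoords y *m imat x.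
Proof.
move=> ix iy; rewrite {1}(icoordsE iy) mulr_sumr mulmx_sum_row.
under eq_bigr => i _ do rewrite mulrCA.
rewrite icoords_lin; first by apply: eq_bigr => i _; rewrite rowK.
by move=> i; apply: integralM => //; apply: integral_basisP.
Qed.

Lemma imatM x y : integral x -> integral y -> imat (x * y) = imat x *m imat y.
Proof.
move=> ix iy; apply/row_matrixP => i; rewrite row_mul !rowK -icoordsM //.
  by congr icoords; rewrite mulrCA mulrA.
by apply: integralM => //; apply: integral_basisP.
Qed.

Lemma imatD x y : integral x -> integral y -> imat (x + y) = imat x + imat y.
Proof.
move=> ix iy; apply/row_matrixP => i; rewrite linearD /= !rowK mulrDl icoordsD //.
all: by apply: integralM => //; apply: integral_basisP.
Qed.

Lemma imatZ (n : int) x : integral x -> imat (n%:~R * x) = n *: imat x.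
Proof.
move=> ix; apply/row_matrixP => i; rewrite linearZ /= !rowK -mulrA icoordsZ //.
by apply: integralM => //; apply: integral_basisP.
Qed.

Lemma imat1 : imat 1 = 1%:M.
Proof. by apply/row_matrixP => i; rewrite rowK mul1r row1 icoords_b. Qed.

Definition itrace x : int := \tr (imat x).

(** The multiplication matrices in [vbasis] and in [b] are conjugate by [coordmx b]. *)
Lemma itraceE x : integral x -> nf_trace x = (itrace x)%:~R.
Proof.
move=> ix; rewrite nf_traceE /itrace.
have E : coordmx b *m mulmat x = map_mx intr (imat x) *m coordmx b.
  apply/row_matrixP => i; rewrite !row_mul !rowK -coordsM.
  rewrite -map_row rowK {1}(icoordsE (integralM ix (integral_basisP i))) mulmx_sum_row.
  under eq_bigr => j _ do rewrite intrM_scale.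
  rewrite coords_lin; apply: eq_bigr => j _; by rewrite rowK [in RHS]mxE.
by rewrite -trace_map_mx -(mulKmx bU (mulmat x)) E mxtrace_mulC mulmxK.
Qed.

Lemma itraceD x y : integral x -> integral y -> itrace (x + y) = itrace x + itrace y.
Proof. by move=> ix iy; rewrite /itrace imatD // mxtraceD. Qed.

Lemma itraceZ (n : int) x : integral x -> itrace (n%:~R * x) = n * itrace x.
Proof. by move=> ix; rewrite /itrace imatZ // mxtraceZ. Qed.

Lemma itrace1 : itrace 1 = d%:Z.
Proof. by rewrite /itrace imat1 mxtrace1 natz. Qed.

(* [integral (x / n%:R)] says that [x] lies in the ideal generated by [n]. *)
Lemma icoords_dvd n x : (0 < n)%N -> integral x ->
  integral (x / n%:R) <-> (forall i, (n %| icoords x 0%R i)%Z).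
Proof.
move=> n_gt0 ix; split=> [ixn i|dv].
  rewrite -[x](divfK (natL_neq0 n_gt0)) mulrC -[n%:R]/(n%:Z%:~R).
  by rewrite icoordsZ // mxE dvdz_mulr.
rewrite [x](icoordsE ix) mulr_suml; apply: integral_sum => i _.
have /dvdzP[q ->] := dv i; rewrite intrM -[n%:Z%:~R]/(n%:R).
rewrite (_ : _ / _ = q%:~R * b i); last by field; apply: natL_neq0.
by apply: integralM (integral_int _ _) _; apply: integral_basisP.
Qed.

End Coordinates.


(** * Reduction modulo p *)

Section Reduction.
Variables (L : fieldExtType rat) (b : 'I_(\dim {:L}) -> L).
Hypothesis bI : integral_basis b.
Variable p : nat.
Hypothesis p_pr : prime p.
Local Notation d := (\dim {:L}).
Local Notation "p %|* x" := (integral (x / p%:R)) (at level 70, x at level 65).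
Implicit Types (x y z : L).

Let p_neq0 : (p%:R : L) != 0 := natL_neq0 L (prime_gt0 p_pr).

Lemma idvdD x y : p %|* x -> p %|* y -> p %|* x + y.
Proof. by rewrite mulrDl; apply: integralD. Qed.

Lemma idvdB x y : p %|* x -> p %|* y -> p %|* x - y.
Proof. by rewrite mulrBl; apply: integralB. Qed.

Lemma idvdM x y : integral x -> p %|* y -> p %|* x * y.
Proof. by rewrite -mulrA; apply: integralM. Qed.

Lemma idvdMp x : integral x -> p %|* p%:R * x.
Proof. by rewrite mulrAC divff ?mul1r. Qed.

Lemma idvd_integral x : p %|* x -> integral x.
Proof.
by move=> px; rewrite -[x](divfK p_neq0); apply: integralM px (integralN _ _).
Qed.

Lemma idvd_exp x y n : integral x -> integral y -> p %|* x - y -> p %|* x ^+ n - y ^+ n.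
Proof.
move=> ix iy pxy; rewrite subrXX [(x - y) * _]mulrC; apply: idvdM => //.
by apply: integral_sum => i _; apply: integralM; apply: integralX.
Qed.

Lemma Frobenius_add x y n : integral x -> integral y ->
  p %|* (x + y) ^+ (p ^ n) - (x ^+ (p ^ n) + y ^+ (p ^ n)).
Proof.
move=> ix iy; elim: n => [|n IH].
  by rewrite !expr1 subrr mul0r; apply: integral_0.
rewrite !expnSr !exprM; set u := x ^+ _ in IH *; set v := y ^+ _ in IH *.
have iu : integral u by apply: integralX.
have iv : integral v by apply: integralX.
have ixy : integral ((x + y) ^+ (p ^ n)) by apply/integralX/integralD.
rewrite -(subrKA ((u + v) ^+ p)); apply: idvdD.
  by apply: idvd_exp => //; apply: integralD.
rewrite exprDn (bigD1 ord0) //= (bigD1 ord_max) //=; last by rewrite -val_eqE /= -lt0n prime_gt0.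
rewrite bin0 binn subn0 subnn !expr0 mulr1 mul1r !mulr1n.
rewrite addrA [X in X / _]addrAC subrr add0r.
rewrite mulr_suml; apply: integral_sum => i /andP[i_neq0 i_neqp].
have /dvdnP[q ->] : (p %| 'C(p, i))%N.
  apply: prime_dvd_bin => //; rewrite lt0n -val_eqE /= in i_neq0 *.
  by rewrite i_neq0 ltn_neqAle -ltnS ltn_ord andbT -val_eqE in i_neqp *.
rewrite mulrnA -[_ *+ p]mulr_natr mulfK //.
by rewrite -mulr_natr; apply: integralM (integralN _ _); apply: integralM; apply: integralX.
Qed.

(** Through [red] the quotient R/pR becomes a space of row vectors, and [rho] is its regular
    representation. The row space of [rho z] is the principal ideal of R/pR generated by [z]. *)
Definition red x : 'rV['F_p]_d := map_mx intr (icoords b x).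
Definition rho x : 'M['F_p]_d := map_mx intr (imat b x).

Lemma intrFp_eq0 (n : int) : (n%:~R == 0 :> 'F_p) = (p %| n)%Z.
Proof. by rewrite -(dvdz_pcharf (pchar_Fp p_pr)). Qed.

Lemma redM x y : integral x -> integral y -> red (x * y) = red y *m rho x.
Proof. by move=> ix iy; rewrite /red icoordsM // map_mxM. Qed.

Lemma redD x y : integral x -> integral y -> red (x + y) = red x + red y.
Proof. by move=> ix iy; rewrite /red icoordsD // map_mxD. Qed.

Lemma rhoM x y : integral x -> integral y -> rho (x * y) = rho x *m rho y.
Proof. by move=> ix iy; rewrite /rho imatM // map_mxM. Qed.

Lemma rhoD x y : integral x -> integral y -> rho (x + y) = rho x + rho y.
Proof. by move=> ix iy; rewrite /rho imatD // map_mxD. Qed.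

Lemma rho1 : rho 1 = 1%:M. Proof. by rewrite /rho imat1 // map_mx1. Qed.

Lemma rhoX x n : integral x -> rho (x ^+ n) = rho x ^+ n.
Proof.
move=> ix; elim: n => [|n IH]; first by rewrite !expr0 rho1.
by rewrite !exprS rhoM ?IH //; apply: integralX.
Qed.

Lemma rho_comm x y : integral x -> integral y -> comm_mx (rho x) (rho y).
Proof. by move=> ix iy; rewrite /comm_mx -!rhoM // mulrC. Qed.

Lemma row_rho i x : row i (rho x) = red (x * b i).
Proof. by rewrite -map_row rowK. Qed.

Lemma red_eq0 x : integral x -> red x = 0 <-> p %|* x.
Proof.
move=> ix; rewrite (icoords_dvd bI (prime_gt0 p_pr) ix); split=> [/rowP r0 i|dv].
  by rewrite -intrFp_eq0; have := r0 i; rewrite [red x 0 i]mxE [RHS]mxE => ->.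
by apply/rowP => i; rewrite [red x 0 i]mxE [RHS]mxE; apply/eqP; rewrite intrFp_eq0.
Qed.

Lemma red_eq x y : integral x -> integral y -> red x = red y <-> p %|* x - y.
Proof.
move=> ix iy; rewrite -(red_eq0 (integralB ix iy)).
have -> : red x = red (x - y) + red y by rewrite -redD ?subrK //; apply: integralB.
by rewrite -[RHS in _ = RHS <-> _]add0r; split=> [/addIr|->].
Qed.

Lemma rho_eq0 x : integral x -> rho x = 0 <-> p %|* x.
Proof.
move=> ix; split=> [r0|px].
  by apply/red_eq0 => //; rewrite -[x]mulr1 redM ?r0 ?mulmx0 //; apply: integral_1.
apply/row_matrixP => i; rewrite row0 row_rho; apply/red_eq0.
  by apply: integralM ix _; apply: integral_basisP.
by rewrite [x * _]mulrC; apply: idvdM px; apply: integral_basisP.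
Qed.

Lemma rho_eq x y : integral x -> integral y -> rho x = rho y <-> p %|* x - y.
Proof.
move=> ix iy; rewrite -(rho_eq0 (integralB ix iy)).
have -> : rho x = rho (x - y) + rho y by rewrite -rhoD ?subrK //; apply: integralB.
by rewrite -[RHS in _ = RHS <-> _]add0r; split=> [/addIr|->].
Qed.

Lemma red_lift (v : 'rV['F_p]_d) : exists2 x, integral x & red x = v.
Proof.
exists (\sum_i ((v 0 i : nat)%:Z)%:~R * b i); first exact: integral_comb.
apply/rowP => i; rewrite /red icoords_sum // !mxE.
by rewrite -[(v 0 i : nat)%:Z%:~R]/((v 0 i : nat)%:R) natr_Zp.
Qed.

Lemma red_sub y z : integral y -> integral z ->
  (red y <= rho z)%MS <-> exists2 a, integral a & p %|* y - a * z.
Proof.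
move=> iy iz; split=> [/submxP[v yv]|[a ia]].
  have [a ia Da] := red_lift v; exists a => //; apply/red_eq => //.
    exact: integralM.
  by rewrite yv -Da -redM // mulrC.
move/red_eq => ->//; last exact: integralM.
by rewrite mulrC redM // submxMl.
Qed.

Lemma rho_sub y z : integral y -> integral z ->
  (rho y <= rho z)%MS <-> exists2 a, integral a & p %|* y - a * z.
Proof.
move=> iy iz; split=> [yz|[a ia yaz]].
  apply/red_sub => //; apply: submx_trans yz.
  by apply/red_sub => //; exists 1; rewrite ?mul1r ?subrr ?mul0r;
    [apply: integral_1 | apply: integral_0].
apply/row_subP => i; rewrite row_rho; have ib := integral_basisP bI i.
apply/red_sub => //; first exact: integralM.
exists (a * b i); first exact: integralM.
by rewrite (_ : _ - _ = b i * (y - a * z)); [apply: idvdM | ring].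
Qed.

Lemma tr_rho x : (\tr (rho x) == 0) = (p %| itrace b x)%Z.
Proof. by rewrite /rho trace_map_mx intrFp_eq0. Qed.

Lemma rank_rho_gt0 x : integral x -> ~ (p %|* x) -> (0 < \rank (rho x))%N.
Proof.
move=> ix npx; rewrite lt0n mxrank_eq0; apply/eqP => /(rho_eq0 ix); exact: npx.
Qed.

(** Modulo p the ideal of x y lies in that of x; equal dimensions force equality. This drives the
    descents on rank below. *)
Lemma eq_rank_rhoM x y : integral x -> integral y ->
  (\rank (rho x) <= \rank (rho (x * y)))%N -> exists2 a, integral a & p %|* x - a * (x * y).
Proof.
move=> ix iy le_r; have ixy := integralM ix iy; apply/rho_sub => //.
have sxy : (rho (x * y) <= rho x)%MS by rewrite mulrC rhoM // submxMl.
by have /mxrank_leqif_sup/geq_leqif <- := sxy.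
Qed.

(* Pigeonhole on the finitely many classes of the [p^n]-th powers of [x]. *)
Lemma Frobenius_periodic x : integral x ->
  exists n k, (0 < k)%N /\ p %|* (x ^+ (p ^ k) - x) ^+ (p ^ n).
Proof.
move=> ix; pose f (i : 'I_(#|{: 'M['F_p]_d}|.+1)) := rho (x ^+ (p ^ i)).
have /injectivePn[i [j ne_ij Eij]] : ~~ injectiveb f.
  by apply/injectiveP => /leq_card; rewrite card_ord ltnn.
wlog lt_ij : i j ne_ij Eij / (i < j)%N.
  by move=> W; have [|lt|/val_inj E] := ltngtP i j;
    [exact: W | apply: (W j i) => //; rewrite eq_sym | rewrite E eqxx in ne_ij].
exists i, (j - i)%N; rewrite subn_gt0; split=> //.
have iX n : integral (x ^+ n) by apply: integralX.
have /rho_eq := esym Eij => /(_ (iX _) (iX _)) px.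
(* Additivity of the p^i-th power gives x^(p^j) - x^(p^i) as the p^i-th power of the difference, and
   this vanishes modulo p by the collision. *)
have := Frobenius_add i ix (integralB (iX (p ^ (j - i))%N) ix).
rewrite [x + _]addrC subrK -exprM -expnD subnK ?(ltnW lt_ij) // => /(idvdB px).
by congr (p %|* _); ring.
Qed.

End Reduction.


(** * Prime ideals over p *)

Section PrimeIdeal.
Variables (L : fieldExtType rat) (b : 'I_(\dim {:L}) -> L).
Hypothesis bI : integral_basis b.
Variable p : nat.
Hypothesis p_pr : prime p.
Local Notation d := (\dim {:L}).
Local Notation "p %|* x" := (integral (x / p%:R)) (at level 70, x at level 65).
Implicit Types (x y z : L).

Let p_neq0 : (p%:R : L) != 0 := natL_neq0 L (prime_gt0 p_pr).
Local Notation rho := (rho b p).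
Local Notation red := (red b p).

(* A multiple of [w] outside [p R] of minimal rank on [R / p R] has a prime annihilator. *)
Lemma associated_prime w : integral w -> ~ (p %|* w) ->
  exists r, [/\ integral r, ~ (p %|* r * w)
    & OL_prime_ideal (fun a : L => integral a /\ p %|* a * (r * w))].
Proof.
move=> iw; move: {2}_.+1 (ltnSn (\rank (rho w))) => n.
elim: n w iw => // n IH w iw; rewrite ltnS => le_n npw.
pose P a := integral a /\ p %|* a * w.
have [Ppr|nPpr] := Classical_Prop.classic
    (forall a c, integral a -> integral c -> P (a * c) -> P a \/ P c).
  exists 1; rewrite mul1r; split=> //; first exact: integral_1.
  split; last by split=> //; rewrite mul1r; case.
  split; first by move=> x [].
  split; first by split; [apply: integral_0 | rewrite !mul0r; apply: integral_0].
  split=> [x y [ix px] [iy py]|a x ia [ix px]]; split.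
  - exact: integralB.
  - by rewrite mulrBl; apply: idvdB.
  - exact: integralM.
  - by rewrite -[a * x * w]mulrA; apply: idvdM.
have [a [c [ia ic pacw npaw npcw]]] : exists a c,
    [/\ integral a, integral c, p %|* a * c * w, ~ p %|* a * w & ~ p %|* c * w].
  apply: Classical_Prop.NNPP => none; apply: nPpr => a c ia ic [_ pac].
  have [pa|npa] := Classical_Prop.classic (p %|* a * w); first by left.
  have [pc|npc] := Classical_Prop.classic (p %|* c * w); first by right.
  by case: none; exists a, c.
(* If w were a multiple of w a modulo p, then c w would be one of a c w, hence zero modulo p. *)
have lt_r : (\rank (rho (w * a)) < \rank (rho w))%N.
  rewrite ltnNge; apply/negP => /(eq_rank_rhoM bI p_pr iw ia) [r ir pr].
  apply: npcw; rewrite (_ : c * w = c * (w - r * (w * a)) + r * (a * c * w)); last by ring.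
  by apply: idvdD; apply: idvdM.
have [||r [ir npr Pr]] := IH (w * a) (integralM iw ia).
- exact: leq_trans lt_r le_n.
- by rewrite [w * a]mulrC.
exists (r * a); rewrite -[r * a * w]mulrA [a * w]mulrC; split=> //.
exact: integralM.
Qed.

Section Over.
Variable P : L -> Prop.
Hypotheses (P_prime : OL_prime_ideal P) (P_p : P p%:R).

Lemma prime_integral x : P x -> integral x.
Proof. by case: P_prime => [[H _] _]; apply: H. Qed.
Lemma prime0 : P 0. Proof. by case: P_prime => [[_ [H _]] _]. Qed.
Lemma primeB x y : P x -> P y -> P (x - y).
Proof. by case: P_prime => [[_ [_ [H _]]] _]; apply: H. Qed.
Lemma primeMr a x : integral a -> P x -> P (a * x).
Proof. by case: P_prime => [[_ [_ [_ H]]] _]; apply: H. Qed.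
Lemma primeD x y : P x -> P y -> P (x + y).
Proof.
by move=> Px Py; rewrite -[y]opprK -[- y]sub0r; do 2!apply: primeB => //; apply: prime0.
Qed.
Lemma prime1 : ~ P 1. Proof. by case: P_prime => [_ []]. Qed.
Lemma prime_mul a c : integral a -> integral c -> P (a * c) -> P a \/ P c.
Proof. by case: P_prime => [_ [_ H]]; apply: H. Qed.

Lemma prime_exp x n : integral x -> P (x ^+ n) -> P x.
Proof.
move=> ix; elim: n => [/prime1 //|n IH]; rewrite exprS.
by case/prime_mul => //; apply: integralX.
Qed.

Lemma prime_idvd x : p %|* x -> P x.
Proof. by move=> px; rewrite -[x](divfK p_neq0); apply: primeMr. Qed.

Lemma prime_Frobenius x : integral x -> exists k, (0 < k)%N /\ P (x ^+ (p ^ k) - x).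
Proof.
move=> ix; have [n [k [k_gt0 pk]]] := Frobenius_periodic bI p_pr ix.
exists k; split=> //; apply: prime_exp (prime_idvd pk).
by apply: integralB => //; apply: integralX.
Qed.

(** Modulo [P] one has s^q = s for some q = p^k, so s^(q - 2) is an inverse; [m] below is q - 2. *)
Lemma prime_inv s : integral s -> ~ P s -> exists2 r, integral r & P (1 - s * r).
Proof.
move=> is_ nPs; have [k [k_gt0 Pk]] := prime_Frobenius is_.
have /subnKC Dq : (2 <= p ^ k)%N.
  by apply: leq_trans (prime_gt1 p_pr) _; rewrite -{1}(expn1 p) leq_exp2l ?prime_gt1.
move: (_ - _)%N Dq => m Dq; rewrite -Dq in Pk.
exists (s ^+ m); first exact: integralX.
have iq : integral (1 - s * s ^+ m).
  by apply: integralB; [apply: integral_1 | apply/integralM/integralX].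
case: (prime_mul is_ iq) => //.
rewrite (_ : _ * _ = 0 - (s ^+ (2 + m) - s)); last by rewrite exprD; ring.
by apply: primeB => //; apply: prime0.
Qed.

(** Here [good w] says that w survives localization at [P]. A good w of minimal rank is killed by
    [P]: if a in [P] does not kill w, then either w a is good and of smaller rank, because 1 - r a
    is outside [P], or some s outside [P] kills w a and w s is good of smaller rank. The quotient y
    / p then multiplies [P] into R without being integral. *)
Lemma prime_annihilator :
  exists y, [/\ integral y, ~ (p %|* y) & forall a, P a -> p %|* a * y].
Proof.
pose good w := forall s, integral s -> ~ P s -> ~ p %|* s * w.
suff H n w : integral w -> (\rank (rho w) < n)%N -> good w ->
    exists y, [/\ integral y, ~ (p %|* y) & forall a, P a -> p %|* a * y].
  apply: (H _ 1 (integral_1 L) (ltnSn _)) => s is_ nPs.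
  by rewrite mulr1 => /prime_idvd.
elim: n w => // n IH w iw; rewrite ltnS => le_n gw.
have [annw|] := Classical_Prop.classic (forall a, P a -> p %|* a * w).
  exists w; split=> // pw; apply: (gw 1); rewrite ?mul1r //; [exact: integral_1 | exact: prime1].
move=> nann; have [a Pa npa] : exists2 a, P a & ~ p %|* a * w.
  apply: Classical_Prop.NNPP => none; apply: nann => a Pa.
  by apply: Classical_Prop.NNPP => npa; apply: none; exists a.
have ia := prime_integral Pa.
have step c : integral c -> good (w * c) -> ~ (exists2 r, integral r & p %|* w - r * (w * c)) ->
    exists y, [/\ integral y, ~ (p %|* y) & forall a, P a -> p %|* a * y].
  move=> ic gwc nr; apply: (IH (w * c)) => //; first exact: integralM.
  apply: leq_trans le_n; rewrite ltnNge; apply/negP.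
  by move/(eq_rank_rhoM bI p_pr iw ic).
have [gwa|ngwa] := Classical_Prop.classic (good (w * a)).
  apply: (step a) => // -[r ir pr].
  have iq : integral (1 - r * a) by apply: integralB (integral_1 _) (integralM ir ia).
  apply: (gw _ iq); last by rewrite (_ : _ * w = w - r * (w * a)) //; ring.
  by move=> Pq; apply: prime1; rewrite -(subrK (r * a) 1); apply: primeD => //; apply: primeMr.
have [s [is_ nPs psa]] : exists s, [/\ integral s, ~ P s & p %|* s * (w * a)].
  apply: Classical_Prop.NNPP => none; apply: ngwa => s is_ nPs psa.
  by apply: none; exists s.
apply: (step s) => // [t it nPt|[r ir pr]].
  rewrite (_ : t * _ = t * s * w); last by ring.
  by apply: gw; [apply: integralM | case/(prime_mul it is_)].
apply: npa; rewrite (_ : _ * w = a * (w - r * (w * s)) + r * (s * (w * a))); last by ring.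
by apply: idvdD; apply: idvdM.
Qed.

Lemma ideal_pow_ideal k :
  [/\ forall x, ideal_pow P k x -> integral x,
      forall x y, ideal_pow P k x -> ideal_pow P k y -> ideal_pow P k (x + y) &
      forall a x, integral a -> ideal_pow P k x -> ideal_pow P k (a * x)].
Proof.
elim: k => [|k [ik Dk Mk]] /=.
  by split=> //; [apply: integralD | apply: integralM].
split=> [x [s [sP ->]]|x y [s [sP ->]] [t [tP ->]]|a x ia [s [sP ->]]].
- rewrite big_seq; apply: integral_sum => u /sP [/ik iu /prime_integral].
  exact: integralM.
- exists (s ++ t); rewrite big_cat; split=> // u; rewrite mem_cat => /orP[/sP|/tP] //.
- exists [seq (a * u.1, u.2) | u <- s]; split.
    by move=> _ /mapP[u /sP[u1 u2] ->]; split=> //=; apply: Mk.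
  by rewrite big_map mulr_sumr; apply: eq_bigr => u _; rewrite /= mulrA.
Qed.

Lemma ideal_powS k x : ideal_pow P k.+1 x -> ideal_pow P k x.
Proof.
have [_ Dk Mk] := ideal_pow_ideal k; case=> s [sP ->].
have P0 : ideal_pow P k 0.
  by case: k {Dk Mk sP} => [|k]; [apply: integral_0 | exists [::]; rewrite big_nil].
elim: s sP => [|u s IH] sP.
  by rewrite big_nil.
rewrite big_cons; apply: Dk; last by apply: IH => v sv; apply: sP; rewrite inE sv orbT.
have [u1 u2] := sP u (mem_head _ _); rewrite mulrC; apply: Mk => //.
exact: prime_integral.
Qed.

Lemma ideal_pow_le k l x : (k <= l)%N -> ideal_pow P l x -> ideal_pow P k x.
Proof.
by move/subnK <-; elim: (l - k)%N => // n IH; rewrite addSn => /ideal_powS.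
Qed.

(* [x] plays the role of a local inverse of a uniformizer at [P]. *)
Section Uniformizer.
Variable x : L.
Hypotheses (xP : forall a, P a -> integral (x * a)) (x_nint : ~ integral x).

(* Otherwise [p x^n] stays in [P] for all [n], which makes [x] integral. *)
Lemma uniformizer_exists : exists2 u, P u & ~ P (x * u).
Proof.
apply: Classical_Prop.NNPP => none; apply: x_nint.
apply: (integral_almost p_neq0) => n; apply: prime_integral.
elim: n => [|n IH]; first by rewrite mulr1.
rewrite exprS mulrCA; apply: Classical_Prop.NNPP => nP; apply: none.
by exists (p%:R * x ^+ n).
Qed.

(** Each p x^i in [P] makes p x^(i+1) integral. If [P] were never left, all p x^n would be integral
    and [integral_almost] would make [x] integral; so [e] is the first exit, and it is positive
    because p lies in [P]. *)
Lemma ramification_exists : exists e, [/\ (0 < e)%N, ~ P (p%:R * x ^+ e)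
  & forall i, (i <= e)%N -> integral (p%:R * x ^+ i)].
Proof.
apply: Classical_Prop.NNPP => none; apply: x_nint.
apply: (integral_almost p_neq0) => n.
suff [H _] : integral (p%:R * x ^+ n) /\ P (p%:R * x ^+ n) by [].
elim/ltn_ind: n => -[|n] IH; first by rewrite mulr1; split=> //; apply: integralN.
have ix : integral (p%:R * x ^+ n.+1).
  by rewrite exprS mulrCA; apply: xP; have [] := IH n (ltnSn n).
split=> //; apply: Classical_Prop.NNPP => nP; apply: none; exists n.+1; split=> // i.
by rewrite leq_eqVlt => /predU1P[->//|/IH[]].
Qed.

Variable e : nat.
Hypotheses (e_gt0 : (0 < e)%N) (h_nP : ~ P (p%:R * x ^+ e))
  (h_int : forall i, (i <= e)%N -> integral (p%:R * x ^+ i)).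
Variable u : L.
Hypotheses (u_P : P u) (xu_nP : ~ P (x * u)).
Local Notation h := (p%:R * x ^+ e).

Let ih : integral h := h_int (leqnn e).
Let iu : integral u := prime_integral u_P.

Lemma ram_index_uniformizer : ram_index p P e.
Proof.
split.
  (* With 1 - x u r in [P], the identity p x^j = p x^(j+1) u r + p x^j (1 - x u r) raises the power
     of [P] by one at each induction step. *)
  have [r ir Pr] := prime_inv (xP u_P) xu_nP.
  suff H k j : (j + k <= e)%N -> ideal_pow P k (p%:R * x ^+ j).
    by have := H e 0%N (leqnn _); rewrite mulr1.
  elim: k j => [|k IH] j le_jk; first by apply: h_int; rewrite addn0 in le_jk.
  exists [:: (p%:R * x ^+ j.+1, u * r); (p%:R * x ^+ j, 1 - x * u * r)]; split.
    move=> pr; rewrite !inE => /orP[]/eqP-> /=; split=> //.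
    - by apply: IH; rewrite addSnnS.
    - by rewrite mulrC; apply: primeMr.
    - by apply: IH; apply: leq_trans le_jk; rewrite leq_add2l.
  by rewrite big_cons big_seq1 /= exprS; ring.
(* Conversely x^k multiplies P^k into R, so p in P^(e+1) would put p x^e in [P]. *)
have powx k z : ideal_pow P k z -> integral (x ^+ k * z).
  elim: k z => [|k IH] z /=; first by rewrite mul1r.
  case=> s [sP ->]; rewrite mulr_sumr big_seq; apply: integral_sum => v /sP[v1 v2].
  rewrite exprSr (_ : _ * _ = (x ^+ k * v.1) * (x * v.2)); last by ring.
  by apply: integralM; [apply: IH | apply: xP].
case=> s [sP ps]; apply: h_nP; rewrite mulrC ps mulr_sumr big_seq.
apply: (big_ind P); [exact: prime0 | exact: primeD |] => v /sP[v1 v2].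
by rewrite mulrA; apply: primeMr => //; apply: powx.
Qed.

Lemma ram_index_unique e' : ram_index p P e' -> e' = e.
Proof.
have [pe npe] := ram_index_uniformizer; case=> pe' npe'.
case: (ltngtP e' e) => // lt; [case: npe' | case: npe].
  exact: ideal_pow_le lt pe.
exact: ideal_pow_le lt pe'.
Qed.

Lemma h_kills_prime_exp a : P a -> p %|* h * a ^+ e.
Proof.
move=> Pa; rewrite -[h * _]mulrA -exprMn; apply: idvdMp => //.
by apply: integralX; apply: xP.
Qed.

(* [h] generates the component at [P] of the finite ring [R / p R], where elements
   outside [P] become invertible. *)
Lemma h_local_inv s : integral s -> ~ P s -> exists2 r, integral r & p %|* h * (1 - s * r).
Proof.
move=> is_ nPs; have [r ir Pr] := prime_inv is_ nPs.
pose q := 1 - s * r; have iq : integral q by apply: prime_integral.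
(* A truncated geometric series: one minus s times this element is q^e with q in [P], and h kills
   that modulo p. *)
exists (r * \sum_(i < e) q ^+ i).
  by apply: integralM => //; apply: integral_sum => i _; apply: integralX.
rewrite (_ : 1 - _ = q ^+ e); first exact: h_kills_prime_exp.
have := subrX1 q e; rewrite (_ : q - 1 = - (s * r)); last by rewrite /q; ring.
by move/(canRL (subrK _)) => ->; ring.
Qed.

(** The row spaces [V j] form a descending filtration of the component [V 0] of R/pR at [P], with
    [V e] zero; [E], which is [V e.-1], is its last layer and is killed by [P]. *)
Local Notation E := (rho (h * u ^+ e.-1)).
Local Notation V j := (rho (h * u ^+ j)).

Let iV j : integral (h * u ^+ j) := integralM ih (integralX j iu).

Lemma socleE : h * u ^+ e.-1 = p%:R * ((x * u) ^+ e.-1 * x).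
Proof. by rewrite -{1}(prednK e_gt0) exprMn exprSr; ring. Qed.

Lemma socle_kills a : P a -> p %|* h * u ^+ e.-1 * a.
Proof.
move=> Pa; rewrite socleE -[p%:R * _ * a]mulrA -[_ * x * a]mulrA; apply: idvdMp => //.
by apply: integralM; [apply/integralX/xP | apply: xP].
Qed.

(** Thus multiplication by [u] maps [V j] onto [V j.+1] with the same kernel for every j, so each of
    the e layers contributes one copy of [E] to traces and ranks. *)
Lemma filtration_ker j : (j < e)%N -> (V j :&: kermx (rho u) :=: E)%MS.
Proof.
move=> lt_je; apply/eqmxP/andP; split; last first.
  rewrite sub_capmx; apply/andP; split.
    apply/rho_sub => //; exists (u ^+ (e.-1 - j)); first exact: integralX.
    rewrite (_ : _ - _ = 0) ?mul0r; first exact: integral_0.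
    rewrite -{1}(subnK (_ : (j <= e.-1)%N)) ?exprD; last by rewrite -ltnS prednK.
    by ring.
  apply/sub_kermxP; rewrite -rhoM //; apply/rho_eq0 => //; first exact: integralM.
  exact: socle_kills.
apply/rV_subP => v; rewrite sub_capmx => /andP[vV /sub_kermxP vu].
have [y iy Dv] := red_lift bI v; rewrite -Dv in vV vu *.
have [a ia pya] := (red_sub bI p_pr iy (iV j)).1 vV.
have pyu : p %|* u * y by apply/(red_eq0 bI p_pr (integralM iu iy)); rewrite redM.
(* This is a h u^(j+1) / p, integral because u y lies in pR. Multiplying the generator of [E] by r
   t, where r inverts (x u)^e on the component, gives back y modulo p. *)
pose t := (x * u) ^+ j.+1 * x ^+ (e - j.+1) * a.
have it : integral t.
  have -> : t = (u * y - u * (y - a * (h * u ^+ j))) / p%:R.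
    rewrite /t exprMn -{2}(subnK lt_je) exprD exprS [u ^+ j.+1]exprS.
    by field.
  by apply: idvdB => //; apply: idvdM.
have ixu := xP u_P.
have [r ir pr] : exists2 r, integral r & p %|* h * (1 - (x * u) ^+ e * r).
  apply: h_local_inv; first exact: integralX.
  by move/(prime_exp ixu).
apply/red_sub => //; exists (r * t); first exact: integralM.
have huj : h * u ^+ j = p%:R * (x * u) ^+ j * (x * x ^+ (e - j.+1)).
  by rewrite -{1}(subnKC lt_je) exprD exprSr exprMn; ring.
have -> : y - r * t * (h * u ^+ e.-1) = (y - a * (h * u ^+ j))
   + (a * u ^+ j) * (h * (1 - (x * u) ^+ e * r)).
  rewrite socleE (_ : a * u ^+ j * _ = a * (h * u ^+ j) * (1 - (x * u) ^+ e * r)); last by ring.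
  rewrite huj /t -{5}(prednK e_gt0) !exprS; move: (x * u) => s; ring.
by apply: idvdD => //; apply: idvdM => //; apply: integralM => //; apply: integralX.
Qed.

Let stableV j y : integral y -> (V j *m rho y <= V j)%MS.
Proof.
move=> iy; rewrite -rhoM //; apply/rho_sub => //; first exact: integralM.
by exists y; rewrite // [y * _]mulrC subrr mul0r; apply: integral_0.
Qed.

Lemma rhoVS j : V j.+1 = V j *m rho u.
Proof. by rewrite exprSr mulrA rhoM. Qed.

Lemma rhoV_e : V e = 0.
Proof. exact/(rho_eq0 bI p_pr (iV e))/h_kills_prime_exp. Qed.

Lemma trace_on_h y : integral y -> trace_on (V 0) (rho y) = e%:R * trace_on E (rho y).
Proof.
move=> iy; suff H k : (k <= e)%N -> trace_on (V (e - k)) (rho y) = k%:R * trace_on E (rho y).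
  by have := H e (leqnn e); rewrite subnn.
elim: k => [|k IH] le_ke; first by rewrite subn0 rhoV_e trace_on0 mul0r.
have Ek : (e - k)%N = (e - k.+1).+1 by rewrite -subSn.
rewrite (trace_on_ker (C := rho u)); first 1 last.
- exact: rho_comm.
- exact: stableV.
rewrite -rhoVS -Ek IH ?(ltnW le_ke) // -natr1 mulrDl mul1r; congr (_ + _).
have kE := @filtration_ker (e - k.+1) (_ : (e - k.+1 < e)%N).
apply: eq_trace_on; first by apply: kE; rewrite ltn_subrL.
rewrite (eqmxMr _ (kE _)) ?kE ?ltn_subrL //; exact: stableV.
Qed.

Lemma rank_h : \rank (V 0) = (e * \rank E)%N.
Proof.
suff H k : (k <= e)%N -> \rank (V (e - k)) = (k * \rank E)%N.
  by have := H e (leqnn e); rewrite subnn.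
elim: k => [|k IH] le_ke; first by rewrite subn0 rhoV_e mxrank0.
have Ek : (e - k)%N = (e - k.+1).+1 by rewrite -subSn.
rewrite -(mxrank_mul_ker (V (e - k.+1)) (rho u)) -rhoVS -Ek IH ?(ltnW le_ke) //.
by rewrite filtration_ker ?ltn_subrL // mulSn addnC.
Qed.

Lemma itrace_idvd y : p %|* y -> (p %| itrace b y)%Z.
Proof.
move=> py; have -> : y = p%:Z%:~R * (y / p%:R) by rewrite mulrC divfK.
by rewrite itraceZ // dvdz_mulr.
Qed.

(** Multiplication by h y sends all of R/pR into [V 0], so its full trace is the trace on [V 0]. *)
Lemma tr_rho_h y : integral y -> \tr (rho (h * y)) = e%:R * trace_on E (rho (h * y)).
Proof.
move=> iy; rewrite -trace_on_h; last exact: integralM.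
rewrite trace_on_range // expr0 mulr1; apply/rho_sub => //; first exact: integralM.
by exists y; rewrite // [y * _]mulrC subrr mul0r; apply: integral_0.
Qed.

Lemma wild_trace y : (p %| e)%N -> integral y -> (p %| itrace b (h * y))%Z.
Proof.
move=> pe iy; rewrite -(tr_rho _ p_pr) tr_rho_h //.
by move: pe; rewrite (dvdn_pcharf (pchar_Fp p_pr)) => /eqP ->; rewrite mul0r.
Qed.

Lemma socle_nidvd : ~ p %|* h * u ^+ e.-1.
Proof.
rewrite socleE mulrAC divff // mul1r => iw; apply: xu_nP.
apply: (prime_exp (n := e)); first exact: xP.
rewrite -(prednK e_gt0) exprSr mulrA; exact: primeMr.
Qed.

(** Since [s] is invertible on the component, the traces of all h y vanish modulo p as well. If p
    did not divide e, the traces on [E] would vanish too, against [trace_on_neq0]: Frobenius powers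
    act on [E] as on the residue field. *)
Lemma trace_vanish_wild s : integral s -> ~ P s ->
  (forall y, integral y -> (p %| itrace b (s * y))%Z) -> (p %| e)%N.
Proof.
move=> is_ nPs Ts; apply: contraT => npe.
have Th y : integral y -> (p %| itrace b (h * y))%Z.
  move=> iy; have [r ir pr] := h_local_inv is_ nPs.
  rewrite (_ : h * y = s * (r * h * y) + y * (h * (1 - s * r))); last by ring.
  have iz : integral (r * h * y) by do 2!apply: integralM => //.
  have pz := idvdM iy pr.
  rewrite itraceD ?rpredD ?Ts ?itrace_idvd //; first exact: integralM.
  exact: idvd_integral pz.
have trE y : integral y -> trace_on E (rho (h * y)) = 0.
  move=> /[dup] iy /Th; rewrite -(tr_rho _ p_pr) tr_rho_h // mulf_eq0.
  by rewrite -(dvdn_pcharf (pchar_Fp p_pr)) (negPf npe) => /eqP.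
pose Y i := rho (b i); pose z := red (h * u ^+ e.-1).
have ib := integral_basisP bI.
have EE : E = \matrix_i (z *m Y i).
  by apply/row_matrixP => i; rewrite row_rho rowK /z /Y -redM // [b i * _]mulrC.
have [k kP] := fin_all_exists (fun i => prime_Frobenius (ib i)).
have [|||||i] := @trace_on_neq0 p d d Y z k p_pr; rewrite -?EE.
- by rewrite -mxrank_eq0 -lt0n rank_rho_gt0 //; exact: socle_nidvd.
- apply/red_sub => //; exists 1; first exact: integral_1.
  by rewrite mul1r subrr mul0r; apply: integral_0.
- by move=> i j; apply: rho_comm.
- by move=> i; apply: stableV.
- move=> i; have [k_gt0 Pk] := kP i; split=> //.
  rewrite /Y -rhoX // -!rhoM //; last exact: integralX.
  apply/(rho_eq bI p_pr (integralM (iV _) (integralX _ (ib i))) (integralM (iV _) (ib i))).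
  by rewrite -mulrBr; apply: socle_kills.
(* On [E] the element [b i] acts as its multiple h r [b i], because h kills 1 - h r modulo p; so the
   vanishing for multiples of h reaches every [b i]. *)
case/negP; have [r ir pr] := h_local_inv ih h_nP.
have iq : integral (1 - h * r) by apply: integralB (integral_1 _) (integralM ih ir).
have ibq : integral (b i * (1 - h * r)) := integralM (ib i) iq.
have q0 : rho (h * u ^+ e.-1 * (b i * (1 - h * r))) = 0.
  apply/(rho_eq0 bI p_pr (integralM (iV _) ibq)).
  rewrite (_ : _ * (b i * _) = (u ^+ e.-1 * b i) * (h * (1 - h * r))); last by ring.
  by apply: idvdM => //; apply: integralM => //; apply: integralX.
rewrite /Y (_ : b i = h * (r * b i) + b i * (1 - h * r)); last by ring.
have irb : integral (r * b i) := integralM ir (ib i).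
rewrite rhoD //; last exact: integralM.
rewrite /trace_on mulmxDr mxtraceD -!/(trace_on _ _) trE // add0r.
by rewrite /trace_on -mulmxA -rhoM // q0 mulmx0 mxtrace0.
Qed.

End Uniformizer.
End Over.
End PrimeIdeal.


(** * The trace form and the discriminant *)

Lemma dvdz_mxM m n k (N : int) (A : 'M[int]_(m, n)) (B : 'M[int]_(n, k)) :
  (forall i j, (N %| A i j)%Z) -> forall i j, (N %| (A *m B) i j)%Z.
Proof.
by move=> NA i j; rewrite mxE; apply: rpred_sum => l _; apply: dvdz_mulr.
Qed.

Lemma dvdz_mxM_unit m n (N : int) (A : 'M[int]_(m, n)) (B : 'M[int]_n) :
  B \in unitmx -> (forall i j, (N %| (A *m B) i j)%Z) -> forall i j, (N %| A i j)%Z.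
Proof. by move=> uB NAB; rewrite -[A](mulmxK uB); apply: dvdz_mxM. Qed.

Lemma absz_det_unit n (A : 'M[int]_n) : A \in unitmx -> absz (\det A) = 1%N.
Proof. by rewrite unitmxE => /unitrP[c [_ /(congr1 absz)]]; rewrite abszM => /eqP;
  rewrite muln_eq1 => /andP[/eqP]. Qed.

Section Smith.
Variables (L : fieldExtType rat) (b : 'I_(\dim {:L}) -> L).
Hypothesis bI : integral_basis b.
Local Notation d := (\dim {:L}).
Local Notation "p %|* x" := (integral (x / p%:R)) (at level 70, x at level 65).
Implicit Types (x y z : L).

Definition igram : 'M[int]_d := \matrix_(i, j) itrace b (b i * b j).

Lemma igramE : \det (\matrix_(i, j) nf_trace (b i * b j)) = (\det igram)%:~R.
Proof.
rewrite -det_map_mx; congr (\det _); apply/matrixP => i j.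
by rewrite !mxE (itraceE bI) //; apply: integralM; apply: integral_basisP.
Qed.

Lemma itrace_lin (I : Type) (r : seq I) (a : I -> int) (u : I -> L) :
  (forall i, integral (u i)) ->
  itrace b (\sum_(i <- r) (a i)%:~R * u i) = \sum_(i <- r) a i * itrace b (u i).
Proof.
move=> iu; elim: r => [|i r IH].
  by rewrite !big_nil; have := itraceZ bI 0 (integral_1 L); rewrite !mul0r.
rewrite !big_cons itraceD ?itraceZ ?IH //.
  by apply: integralM => //; apply: integral_int.
by apply: integral_sum => j _; apply: integralM => //; apply: integral_int.
Qed.

Lemma itraceM_b y j : integral y -> itrace b (y * b j) = (icoords b y *m igram) 0 j.
Proof.
move=> iy; rewrite {1}(icoordsE bI iy) mulr_suml.
under eq_bigr => i _ do rewrite -mulrA.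
rewrite itrace_lin; last by move=> i; apply: integralM; apply: integral_basisP.
by rewrite [RHS]mxE; apply: eq_bigr => i _; rewrite [igram i j]mxE.
Qed.

Lemma dvd_itraceP (N : int) y : integral y ->
  (forall z, integral z -> (N %| itrace b (y * z))%Z) <->
  (forall i j, (N %| (icoords b y *m igram) i j)%Z).
Proof.
move=> iy; split=> [Nt i j|NG z iz].
  by rewrite ord1 -itraceM_b //; apply: Nt; apply: integral_basisP.
rewrite (icoordsE bI iz) mulr_sumr; under eq_bigr => i _ do rewrite mulrCA.
rewrite itrace_lin; last by move=> i; apply: integralM => //; apply: integral_basisP.
by apply: rpred_sum => i _; apply: dvdz_mull; rewrite itraceM_b.
Qed.

(** The left unimodular factor of the Smith form changes the basis of R and the right one only the
    dual side. In the coordinates [sc], divisibility of an element and divisibility of all its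
    traces are both read one coordinate at a time. *)
Lemma smith_gram : exists (sc : L -> 'rV[int]_d) (dd : 'I_d -> int),
  [/\ forall c : 'rV[int]_d, exists2 y, integral y & sc y = c,
      forall n y, (0 < n)%N -> integral y -> n %|* y <-> (forall i, (n %| sc y 0%R i)%Z),
      forall (N : int) y, integral y ->
        (forall z, integral z -> (N %| itrace b (y * z))%Z) <->
        (forall i, (N %| sc y 0%R i * dd i)%Z) &
      [/\ forall x y, integral x -> integral y -> sc (x + y) = sc x + sc y,
          forall (n : int) x, integral x -> sc (n%:~R * x) = n *: sc x,
          forall i j : 'I_d, (i <= j)%N -> (dd i %| dd j)%Z &
          absz (\prod_i dd i) = absz (\det igram)]].
Proof.
have [S uS [T uT [ds sds DG]]] := int_Smith_normal_form igram.
pose dd (i : 'I_d) := ds`_i.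
have Dds : (\matrix_(i, j) (ds`_i *+ (i == j :> nat))) = diag_mx (\row_i dd i) :> 'M_d.
  by apply/matrixP => i j; rewrite !mxE.
rewrite Dds in DG.
exists (fun y => icoords b y *m S), dd; split.
- move=> c; pose y := \sum_i ((c *m invmx S) 0 i)%:~R * b i.
  exists y; first exact: integral_comb.
  rewrite /y icoords_sum // -[RHS](mulmxKV uS); congr (_ *m _).
  by apply/rowP => i; rewrite mxE.
- move=> n y n_gt0 iy; rewrite (icoords_dvd bI n_gt0 iy); split=> nd i.
    by apply: dvdz_mxM => k j; rewrite ord1.
  by apply: (dvdz_mxM_unit uS) => k j; rewrite ord1.
- move=> N y iy; rewrite dvd_itraceP // DG !mulmxA mul_mx_diag.
  split=> [NG i|Ni].
    by have := dvdz_mxM_unit uT NG 0 i; rewrite [X in (_ %| X)%Z]mxE [(\row_j _) _ _]mxE.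
  by apply: dvdz_mxM => i j; rewrite ord1 [X in (_ %| X)%Z]mxE [(\row_j _) _ _]mxE.
- split=> [x y ix iy|n x ix|i j le_ij|].
  + by rewrite icoordsD // mulmxDl.
  + by rewrite icoordsZ // scalemxAl.
  + rewrite /dd; case: (ltnP j (size ds)) => [lt_j|le_j];
    last by rewrite (nth_default _ le_j) dvdz0.
    have tr_dvd : transitive dvdz by move=> m1 m2 m3; apply: dvdz_trans.
    by apply: (sorted_leq_nth tr_dvd dvdzz) => //; apply: leq_ltn_trans lt_j.
  rewrite DG !det_mulmx det_diag !abszM !absz_det_unit // mul1n muln1.
  by congr absz; apply: eq_bigr => i _; rewrite mxE.
Qed.
End Smith.

Section TraceIdeal.
Variables (L : fieldExtType rat) (b : 'I_(\dim {:L}) -> L).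
Hypothesis bI : integral_basis b.
Local Notation d := (\dim {:L}).
Local Notation "p %|* x" := (integral (x / p%:R)) (at level 70, x at level 65).
Implicit Types (x y z : L).

(** Euclidean descent among the positive values of the trace, starting from the degree as the trace
    of 1. *)
Lemma trace_gen_exists : exists t, @is_trace_gen L t.
Proof.
suff H n : (0 < n)%N -> (exists2 x, integral x & itrace b x = n%:Z) -> exists t, @is_trace_gen L t.
  apply: (H d (dim_gt0 L)); exists 1; [exact: integral_1 | exact: itrace1].
elim/ltn_ind: n => n IH n_gt0 [x ix Tx].
have [div|ndiv] := Classical_Prop.classic (forall y, integral y -> (n %| itrace b y)%Z).
  exists n; split=> // q; split=> [[y [iy <-]]|[z ->]].
    by have /dvdzP[z Dz] := div y iy; exists z; rewrite (itraceE bI iy) Dz.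
  exists (z%:~R * x); have ix' : integral (z%:~R * x) by apply: integralM (integral_int _ _) ix.
  by rewrite (itraceE bI ix') itraceZ // Tx.
have [y iy ny] : exists2 y, integral y & ~ (n %| itrace b y)%Z.
  apply: Classical_Prop.NNPP => none; apply: ndiv => y iy.
  by apply: contraT => /negP ny; case: none; exists y.
pose r := (itrace b y %% n)%Z.
have r_ge0 : 0 <= r by apply: modz_ge0; lia.
have Dr : r = (absz r)%:Z by rewrite gez0_abs.
apply: (IH (absz r)).
- by rewrite -ltz_nat -Dr ltz_pmod.
- by rewrite lt0n absz_eq0; apply/negP => /eqP /dvdz_mod0P.
exists (y - (itrace b y %/ n)%Z%:~R * x).
  by apply: integralB iy (integralM (integral_int _ _) ix).
rewrite -mulNr -rmorphN itraceD ?itraceZ //; last exact: integralM (integral_int _ _) ix.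
by rewrite Tx -Dr /r /modz mulNr.
Qed.

Lemma propA_of_dvd p : prime p -> (forall y, integral y -> (p %| itrace b y)%Z) -> propA L.
Proof.
move=> p_pr pT; have [t [t_gt0 tT]] := trace_gen_exists; exists t; split=> //.
have [x [ix Tx]] : exists x : L, integral x /\ nf_trace x = t%:R.
  by apply/tT; exists 1; rewrite mul1r.
have := pT x ix; move: Tx; rewrite (itraceE bI ix) -[t%:R]/(t%:Z%:~R) => /intr_inj ->.
by rewrite dvdzE /= => /(dvdn_leq t_gt0); apply: leq_trans; apply: prime_gt1.
Qed.

Lemma propA_dvd : propA L -> exists2 p, prime p & forall y, integral y -> (p %| itrace b y)%Z.
Proof.
case=> t [[t_gt0 tT] t_gt1]; exists (pdiv t); first exact: pdiv_prime.
move=> y iy; have [z] := (tT (nf_trace y)).1 (ex_intro _ y (conj iy erefl)).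
rewrite (itraceE bI iy) => /intr_inj ->; apply: dvdz_mull.
by rewrite dvdzE /= pdiv_dvd.
Qed.

Lemma propA_propB : propA L -> propB L.
Proof.
case/propA_dvd=> p p_pr pT; exists p, (\det (igram b)); split=> //; split.
  by have := pT 1 (integral_1 L); rewrite itrace1 // dvdzE.
split; first by exists b; split=> //; rewrite igramE.
pose G := \matrix_(i, j) (igram b i j %/ p)%Z.
have -> : igram b = p%:Z *: G.
  apply/matrixP => i j; rewrite [RHS]mxE [G i j]mxE mulrC divzK //.
  by rewrite mxE; apply: pT; apply: integralM; apply: integral_basisP.
by rewrite detZ dvdz_mulr // dvdzE abszX.
Qed.

Lemma itrace_sub_dvd p h y : prime p -> integral y -> integral h ->
  (forall z, integral z -> (p %| itrace b (h * z))%Z) ->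
  (exists2 a, integral a & p %|* 1 - a * h) -> (p %| itrace b y)%Z.
Proof.
move=> p_pr iy ih Th [a ia pah].
rewrite (_ : y = h * (a * y) + y * (1 - a * h)); last by ring.
have pz := idvdM iy pah.
have iay := integralM ia iy.
rewrite itraceD ?rpredD ?Th ?(itrace_idvd bI p_pr pz) //; first exact: integralM.
exact: (idvd_integral p_pr pz).
Qed.

(** The local results for x = y / p, with y from [prime_annihilator]. The index [e] is characterized
    as the only ramification index, so that a given witness of wild ramification can be identified
    with it. *)
Lemma prime_component p P : prime p -> OL_prime_ideal P -> P p%:R ->
  exists h e, [/\ integral h, ~ P h, (0 < e)%N /\ (forall e', ram_index p P e' <-> e' = e),
   (p %| e)%N -> forall y, integral y -> (p %| itrace b (h * y))%Z &
   [/\ (exists2 s, integral s & ~ P s /\ forall y, integral y -> (p %| itrace b (s * y))%Z) ->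
         (p %| e)%N,
       (e %| \rank (rho b p h))%N &
       forall s, integral s -> ~ P s -> exists2 r, integral r & p %|* h * (1 - s * r)]].
Proof.
move=> p_pr P_prime P_p.
have [y [iy npy Py]] := prime_annihilator bI p_pr P_prime P_p.
have xP a : P a -> integral (y / p%:R * a).
  by move=> /Py pa; rewrite mulrAC [y * a]mulrC.
have [u uP xuP] := uniformizer_exists p_pr P_prime P_p npy.
have [e [e_gt0 hP ih]] := ramification_exists p_pr P_p xP npy.
exists (p%:R * (y / p%:R) ^+ e), e; split=> //.
- exact: ih.
- have Re := ram_index_uniformizer bI p_pr P_prime P_p xP hP ih uP xuP.
  split=> // e'; split=> [|->//].
  exact: (ram_index_unique bI p_pr P_prime P_p xP hP ih uP xuP).
- move=> pe z iz; exact: (wild_trace bI p_pr P_prime P_p xP e_gt0 ih uP xuP).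
split.
- case=> s is_ [nPs Ts].
  exact: (trace_vanish_wild bI p_pr P_prime P_p xP e_gt0 hP ih uP xuP is_ nPs Ts).
- have := rank_h bI p_pr P_prime P_p xP e_gt0 ih uP xuP.
  by rewrite expr0 mulr1 => ->; apply: dvdn_mulr.
by move=> s; apply: (h_local_inv bI p_pr P_prime P_p xP).
Qed.
End TraceIdeal.


(** * From a divisible discriminant to wild ramification *)

Section Discriminant.
Variables (L : fieldExtType rat) (b : 'I_(\dim {:L}) -> L).
Hypothesis bI : integral_basis b.
Local Notation d := (\dim {:L}).
Local Notation "p %|* x" := (integral (x / p%:R)) (at level 70, x at level 65).
Implicit Types (x y z : L).

Lemma idvd1 n : (1 < n)%N -> ~ n %|* (1 : L).
Proof.
move=> n_gt1 i1; have n_neq0 := natL_neq0 L (ltnW n_gt1).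
have := imatZ bI n%:Z i1; rewrite mul1r -[n%:Z%:~R]/(n%:R : L) divff // imat1 //.
move/(congr1 determinant); rewrite det1 detZ => /esym/(congr1 absz).
rewrite abszM abszX /= => /eqP; rewrite muln_eq1 => /andP[/eqP E _].
by have : (1 < n ^ d)%N; [rewrite -(exp1n d) ltn_exp2r ?dim_gt0 | rewrite E].
Qed.

Lemma disc_trace p : prime p -> ((p ^ d)%:Z %| \det (igram b))%Z ->
  (forall y, integral y -> (p %| itrace b y)%Z) \/
  exists w, [/\ integral w, ~ p %|* w
    & forall y, integral y -> ((p ^ 2)%:Z %| itrace b (w * y))%Z].
Proof.
move=> p_pr pD; have [sc [dd [sc_surj sc_dvd sc_tr [_ _ _ prod_dd]]]] := smith_gram bI.
have [/existsP[i p2i]|/existsPn np2] := boolP [exists i, ((p ^ 2)%:Z %| dd i)%Z].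
  right; have [w iw Dw] := sc_surj (delta_mx 0 i).
  exists w; split=> //.
    move/(sc_dvd _ _ (prime_gt0 p_pr) iw)/(_ i); rewrite Dw mxE !eqxx dvdzE dvdn1.
    by move=> /eqP /= p1; rewrite p1 in p_pr.
  apply/sc_tr => // j; rewrite Dw mxE eqxx /=; case: eqP => [->|_].
    by rewrite mul1r.
  by rewrite mul0r dvdz0.
(* No invariant factor is divisible by p^2, so none is zero and all d valuations at p are at most 1.
   Their sum is at least d, so each equals 1. *)
left; have pdd i : (p %| dd i)%Z.
  have dd0 j : (0 < absz (dd j))%N.
    by rewrite absz_gt0; apply: contra (np2 j) => /eqP->; rewrite dvdz0.
  have lt2 j : (logn p (absz (dd j)) <= 1)%N.
    by rewrite leqNgt; apply: contra (np2 j); rewrite dvdzE pfactor_dvdn.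
  have le_d : (d <= \sum_j logn p (absz (dd j)))%N.
    move: pD; rewrite dvdzE /= -prod_dd.
    have -> : absz (\prod_j dd j) = (\prod_j absz (dd j))%N.
      by elim/big_rec2: _ => // j y1 y2 _ <-; rewrite abszM.
    rewrite pfactor_dvdn ?prodn_gt0 //; move/leq_trans; apply.
    suff [] : (0 < \prod_j absz (dd j))%N /\
        (logn p (\prod_j absz (dd j)) <= \sum_j logn p (absz (dd j)))%N by [].
    elim/big_rec2: _; first by rewrite logn1.
    by move=> j y1 y2 _ [y1_gt0 le]; rewrite muln_gt0 dd0 lognM // leq_add2l.
  rewrite dvdzE /= -[p]expn1 pfactor_dvdn // leqNgt ltnS leqn0.
  apply: contraL le_d => /eqP v0; rewrite -ltnNge (bigD1 i) //= v0 add0n.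
  have : (\sum_(j | j != i) logn p (absz (dd j)) <= \sum_(j | j != i) 1)%N by apply: leq_sum.
  move/leq_ltn_trans; apply; rewrite sum1_card cardC1 card_ord.
  by rewrite prednK ?dim_gt0.
move=> y iy; rewrite -[y]mul1r; move: y iy; apply/sc_tr; first exact: integral_1.
by move=> i; apply: dvdz_mull.
Qed.

(** If all traces are divisible by p, any associated prime works with s = 1. Otherwise dividing r w
    by p costs one of the two factors p in the traces of w, and s = (r w / p) u keeps the other. *)
Lemma trace_prime p : prime p -> ((p ^ d)%:Z %| \det (igram b))%Z ->
  exists P, [/\ OL_prime_ideal P, P p%:R
    & exists2 s, integral s & ~ P s /\ forall y, integral y -> (p %| itrace b (s * y))%Z].
Proof.
move=> p_pr /(disc_trace p_pr) [pT|[w [iw npw p2T]]].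
  have [r [ir npr Pr]] := associated_prime bI p_pr (integral_1 L) (idvd1 (prime_gt1 p_pr)).
  rewrite mulr1 in npr Pr; exists (fun a => integral a /\ p %|* a * r); split=> //.
    by split; [apply: integralN | exact: (idvdMp p_pr ir)].
  exists 1; first exact: integral_1.
  by split=> [|y iy]; [case; rewrite mul1r | rewrite mul1r pT].
have [r [ir npr Pr]] := associated_prime bI p_pr iw npw.
set P := fun a => _ in Pr; have Pp : P p%:R.
  split; [apply: integralN | exact: (idvdMp p_pr (integralM ir iw))].
have [u uP xuP] := uniformizer_exists p_pr Pr Pp npr.
exists P; split=> //; have [iu pu] := uP.
have is_ : integral (r * w / p%:R * u) by rewrite mulrAC [_ * u]mulrC.
exists (r * w / p%:R * u) => //; split=> // y iy.
have p_neq0 := natL_neq0 L (prime_gt0 p_pr).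
have iy' : integral (r * u * y) by do 2!apply: integralM => //.
have := p2T _ iy'; rewrite (_ : w * _ = p%:Z%:~R * (r * w / p%:R * u * y)).
  rewrite itraceZ //; last exact: integralM.
  by rewrite expnS expn1 PoszM dvdz_mul2l // -lt0n prime_gt0.
by rewrite -[p%:Z%:~R]/(p%:R : L); field.
Qed.

End Discriminant.

(** Common starting point of B => C and of both cases of B => A. *)
Lemma propB_component (L : fieldExtType rat) : propB L -> exists p b P h, [/\ prime p,
    (p %| \dim {:L})%N,
    integral_basis b /\ ((p ^ \dim {:L})%:Z %| \det (igram b))%Z,
    OL_prime_ideal P /\ P p%:R &
  [/\ integral h, ~ P h, forall y : L, integral y -> (p %| itrace b (h * y))%Z,
    (p %| \rank (rho b p h))%N &
    (forall s, integral s -> ~ P s ->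
       exists2 r, integral r & integral (h * (1 - s * r) / p%:R)) /\ wildly_ramified L p]].
Proof.
case=> p [D [p_pr [pd [[b [bI DD]] pD]]]].
have {DD}pD : ((p ^ \dim {:L})%:Z %| \det (igram b))%Z.
  by move: DD; rewrite igramE // => /intr_inj ->.
have [P [P_prime P_p Ps]] := trace_prime bI p_pr pD.
have [h [e [ih hP [e_gt0 Re] wT [/(_ Ps) pe er hinv]]]] := prime_component bI p_pr P_prime P_p.
exists p, b, P, h; split=> //; split=> //.
- exact: wT.
- exact: dvdn_trans pe er.
split=> //; by exists P, e; split=> //; split; [apply/Re | split].
Qed.

Lemma propB_propC (L : fieldExtType rat) : propB L -> propC L.
Proof.
by move=> /propB_component[p [b [P [h [p_pr _ _ _ [_ _ _ _ [_ W]]]]]]]; exists p.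
Qed.

Lemma propB_propA_prime (L : fieldExtType rat) : prime (nf_degree L) -> propB L -> propA L.
Proof.
move=> d_pr /propB_component[p [b [P [h [p_pr pd [bI _] [P_prime P_p] [ih hP Th pr _]]]]]].
have Dp : p = \dim {:L} by apply/eqP; rewrite -dvdn_prime2.
have full : row_full (rho b p h).
  rewrite /row_full eqn_leq rank_leq_col /= -{1}Dp; apply: dvdn_leq pr.
  by apply: rank_rho_gt0 => // /(prime_idvd p_pr P_prime P_p).
apply: (propA_of_dvd bI p_pr) => y iy.
apply: (itrace_sub_dvd bI p_pr iy ih Th).
by apply/(rho_sub bI p_pr (integral_1 L) ih); rewrite submx_full.
Qed.


(** * Degree four *)

Lemma odd_dvdz (a : int) : ~~ (2 %| a)%Z -> exists k, a = 2 * k + 1.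
Proof.
move=> na; exists (a %/ 2)%Z; rewrite mulrC {1}(divz_eq a 2); congr (_ + _).
have : (a %% 2)%Z < 2 by apply: ltz_pmod.
have : 0 <= (a %% 2)%Z by apply: modz_ge0.
have : (a %% 2)%Z != 0 by apply: contra na => /eqP/dvdz_mod0P.
by lia.
Qed.

Lemma odd_coprimez n (a : int) : ~~ (2 %| a)%Z -> coprimez (2 ^ n)%N a.
Proof. by rewrite dvdzE coprimezE /= => na; rewrite coprimeXl // prime_coprime. Qed.

(** An odd [a] can be cancelled modulo 4, leaving a x = 1; for even [a] the term a x a vanishes
    modulo 4, and hence so does [a]. *)
Lemma dvdz4_idempotent (a x : int) : (4 %| a * x * a - a)%Z ->
  (4 %| a * x - (~~ (2 %| a)%Z)%:Z)%Z /\ ((2 %| a)%Z -> (4 %| a)%Z).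
Proof.
case: (boolP (2 %| a)%Z) => [/dvdzP[k ->]|/odd_dvdz[k ->]] /dvdzP[q Dq].
  have : (4 %| k * 2)%Z.
    by apply/dvdzP; exists (k ^+ 2 * x - q); lia.
  by move=> k4; split=> //=; rewrite subr0 dvdz_mulr.
split=> // /=; apply/dvdzP.
(* the odd number [2 k + 1] is its own inverse modulo 4 *)
exists (q * (2 * k + 1) - ((2 * k + 1) * x - 1) * (k ^+ 2 + k)).
by rewrite mulrBl [q * _ * 4]mulrAC -Dq; ring.
Qed.

(* [k] is the number of odd invariant factors of [U]. *)
Lemma idempotent_mod4_trace n (U : 'M[int]_n) :
  (forall i j, (4 %| (U *m U - U) i j)%Z) ->
  exists2 k, (k <= n)%N & [/\ (4 %| \tr U - k%:Z)%Z,
    k = 0%N -> forall i j, (2 %| U i j)%Z & k = n -> ~~ (2 %| \det U)%Z].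
Proof.
move=> U4; have [S uS [T uT [ds _ DU]]] := int_Smith_normal_form U.
pose dd (i : 'I_n) := ds`_i.
have Dds : (\matrix_(i, j) (ds`_i *+ (i == j :> nat))) = diag_mx (\row_i dd i) :> 'M_n.
  by apply/matrixP => i j; rewrite !mxE.
rewrite {}Dds in DU; set D := diag_mx _ in DU.
pose X := T *m S.
(* Cancelling the unimodular factors in U U = U modulo 4 leaves D X D = D, and the trace of U is
   that of D X. *)
have X4 i : (4 %| dd i * X i i * dd i - dd i)%Z.
  have : forall i j, (4 %| (D *m X *m D - D) i j)%Z.
    apply: (dvdz_mxM_unit uT) => a c.
    have -> : (D *m X *m D - D) *m T = invmx S *m (U *m U - U).
      have SU : invmx S *m U = D *m T by rewrite DU -mulmxA mulKmx.
      rewrite mulmxBl mulmxBr (mulmxA (invmx S)) SU; congr (_ - _).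
      by rewrite DU /X !mulmxA.
    by rewrite mxE; apply: rpred_sum => l _; apply: dvdz_mull.
  by move/(_ i i); rewrite mul_mx_diag mul_diag_mx !mxE eqxx.
exists #|[pred i | ~~ (2 %| dd i)%Z]|.
  by rewrite -[X in (_ <= X)%N]card_ord max_card.
have trU : \tr U = \sum_i dd i * X i i.
  rewrite DU mxtrace_mulC mulmxA mxtrace_mulC -/X; apply: eq_bigr => i _.
  by rewrite mul_diag_mx !mxE.
split.
- rewrite trU -sum1_card -natz natr_sum [X in _ - X]big_mkcond /= -sumrB.
  apply: rpred_sum => i _; have [+ _] := dvdz4_idempotent (X4 i).
  by rewrite inE; case: (2 %| dd i)%Z.
- move/card0_eq => ev i j; rewrite DU; move: i j.
  have D2 : forall i j, (2 %| D i j)%Z.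
    move=> i j; rewrite !mxE; case: eqP => [->|_] /=; last by rewrite dvdz0.
    by have := ev j; rewrite inE => /negbFE.
  have SD2 i j : (2 %| (S *m D) i j)%Z by rewrite mxE; apply: rpred_sum => l _; apply: dvdz_mull.
  exact: dvdz_mxM.
move=> kn; have od i : ~~ (2 %| dd i)%Z.
  have : [pred i | ~~ (2 %| dd i)%Z] =i predT.
    by apply/subset_cardP; [rewrite kn card_ord | apply/subsetP].
  by move/(_ i); rewrite inE.
rewrite dvdzE DU !det_mulmx det_diag !abszM !absz_det_unit // mul1n muln1.
under eq_bigr => i _ do rewrite mxE.
elim/big_rec: _ => // i y _ IH; rewrite abszM Euclid_dvdM // negb_or IH andbT.
by have := od i; rewrite dvdzE.
Qed.

Lemma four_ord n (dd : 'I_n -> int) : n = 4%N -> exists i0 i1 i2 i3 : 'I_n,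
  [/\ [/\ i0 = 0%N :> nat, i1 = 1%N :> nat, i2 = 2%N :> nat & i3 = 3%N :> nat],
      forall i, [|| i == i0, i == i1, i == i2 | i == i3] &
      \prod_i dd i = dd i0 * dd i1 * dd i2 * dd i3].
Proof.
move=> n4; move: dd; rewrite n4 => dd.
exists (inord 0), (inord 1), (inord 2), (inord 3); split.
- by rewrite !inordK.
- by move=> i; rewrite -!val_eqE /= !inordK //; case: i => -[|[|[|[|]]]].
rewrite !big_ord_recl big_ord0 mulr1 !mulrA.
by do !congr (_ * _); congr dd; apply/val_inj; rewrite /= inordK.
Qed.

Section Quartic.
Variables (L : fieldExtType rat) (b : 'I_(\dim {:L}) -> L).
Hypothesis bI : integral_basis b.
Local Notation d := (\dim {:L}).
Local Notation "p %|* x" := (integral (x / p%:R)) (at level 70, x at level 65).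
Implicit Types (x y z : L).

(* [trv N y] says that [y / N] lies in the dual of the ring of integers for the trace form. *)
Definition trv (N : int) y := forall z, integral z -> (N %| itrace b (y * z))%Z.

Lemma trvD N x y : integral x -> integral y -> trv N x -> trv N y -> trv N (x + y).
Proof.
move=> ix iy Nx Ny z iz; rewrite mulrDl itraceD ?rpredD ?Nx ?Ny //; exact: integralM.
Qed.

Lemma trvM N x a : integral a -> trv N x -> trv N (x * a).
Proof. by move=> ia Nx z iz; rewrite -mulrA; apply: Nx; apply: integralM. Qed.

Lemma trvW M N x : (M %| N)%Z -> trv N x -> trv M x.
Proof. by move=> MN Nx z iz; apply: dvdz_trans MN (Nx z iz). Qed.

Lemma trv_itrace N x : trv N x -> (N %| itrace b x)%Z.
Proof. by move/(_ 1 (integral_1 L)); rewrite mulr1. Qed.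

Lemma trv_nat n x : (0 < n)%N -> n %|* x -> trv n x.
Proof.
move=> n_gt0 nx z iz; have n_neq0 := natL_neq0 L n_gt0.
rewrite (_ : x * z = n%:Z%:~R * (x / n%:R * z)).
  by rewrite itraceZ // ?dvdz_mulr //; apply: integralM.
by rewrite -[n%:Z%:~R]/(n%:R : L); field.
Qed.

Hypothesis nA : ~ forall y, integral y -> (2 %| itrace b y)%Z.
Hypothesis d4 : d = 4%N.

(** The trace is congruent modulo 4 to some k between 0 and 4. A trace divisible by 4 leaves k = 0,
    where y is divisible by 2, or k = 4, where y is invertible modulo 2 and all traces become
    even. *)
Lemma idempotent_trace y : integral y -> 4 %|* y ^+ 2 - y -> ~ 2 %|* y -> trv 2 y ->
  ~ (4 %| itrace b y)%Z.
Proof.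
move=> iy y4 ny2 y2 ty.
have iy2 : integral (y ^+ 2 - y) by apply: integralB => //; apply: integralX.
have U4 i j : (4 %| (imat b y *m imat b y - imat b y) i j)%Z.
  rewrite -imatM // -scaleN1r -imatZ // -imatD //; last first.
  - by apply: integralM (integral_int _ _) iy.
  - exact: integralM.
  have ibj := integral_basisP bI i.
  have im : integral ((y * y + (-1)%:~R * y) * b i / 4%:R).
    rewrite (_ : _ / _ = (y ^+ 2 - y) / 4%:R * b i); last by rewrite rmorphN1; field;
      rewrite natL_neq0.
    exact: integralM.
  rewrite mxE; move: j; apply/(icoords_dvd bI _ _) => //.
  have := integralM im (integralN L 4); rewrite divfK //; exact: natL_neq0.
have [k le_kd [tk k0 kd]] := idempotent_mod4_trace U4.
have := rpredB ty tk; rewrite /itrace subKr => k4; move: k4.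
rewrite dvdzE /=; rewrite {1}d4 in le_kd; case: k le_kd k0 kd {tk} => [|[|[|[|[|]]]]] //= _.
  move=> /(_ erefl) U2 _ _; apply: ny2; apply/(icoords_dvd bI) => // i.
  have -> : icoords b y = icoords b 1 *m imat b y by rewrite -icoordsM ?mulr1 //; apply: integral_1.
  by rewrite mxE; apply: rpred_sum => l _; apply: dvdz_mull.
move=> _ /(_ (esym d4)) odet _; apply: nA => x ix.
(* The adjugate provides z with y z equal to the determinant of [imat b y], an odd integer. *)
pose a := icoords b 1 *m \adj (imat b y).
pose z := \sum_i (a 0 i)%:~R * b i.
have iz : integral z by apply: integral_comb.
have zy : y * z = (\det (imat b y))%:~R * 1.
  have i1 := integral_1 L.
  apply: (icoords_inj bI); [exact: integralM | exact: integralM (integral_int _ _) i1 |].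
  rewrite icoordsZ // icoordsM // /z icoords_sum //.
  rewrite (_ : \row_i a 0 i = a); last by apply/rowP => i; rewrite mxE.
  by rewrite /a -mulmxA mul_adj_mx mul_mx_scalar.
have := y2 (z * x) (integralM iz ix); rewrite mulrA zy mulr1 itraceZ // dvdzE abszM Euclid_dvdM //.
by case/orP=> // d2; case/negP: odet; rewrite dvdzE.
Qed.

Variable u : L.
Hypotheses (iu : integral u) (u4 : 4 %|* u ^+ 2 - u) (nu2 : ~ 2 %|* u) (tu : trv 2 u).

Let two_neq0 : (2%:R : L) != 0 := natL_neq0 L (n := 2) isT.
Let four_neq0 : (4%:R : L) != 0 := natL_neq0 L (n := 4) isT.

(** Squares of elements congruent modulo 2 agree modulo 4, so u = u^2 = y^2 modulo 4; [trv 4 y]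
    would make the trace of y y, hence that of u, divisible by 4. *)
Lemma no_trv4_lift y : integral y -> 2 %|* y - u -> ~ trv 4 y.
Proof.
move=> iy yu ty; apply: (idempotent_trace iu u4 nu2 tu).
have iu2 : integral (u ^+ 2 - u) by apply: integralB => //; apply: integralX.
set r := (y - u) / 2%:R in yu.
have Dy : y = u + 2%:R * r by rewrite /r; field.
have iw : integral (u * r + r ^+ 2) by apply: integralD; [apply: integralM | apply: integralX].
have Du : u = y * y + (- ((u ^+ 2 - u) + 4%:Z%:~R * (u * r + r ^+ 2))).
  by rewrite Dy -[4%:Z%:~R]/(4%:R : L); ring.
have iB : integral (- ((u ^+ 2 - u) + 4%:Z%:~R * (u * r + r ^+ 2))).
  rewrite -sub0r; apply: integralB (integral_0 _) _; apply: integralD => //.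
  by apply: integralM iw; apply: integral_int.
rewrite Du (itraceD bI (integralM iy iy) iB).
apply: rpredD; first exact: ty.
apply: trv_itrace; apply: trv_nat => //; rewrite mulNr -sub0r.
apply: integralB (integral_0 _) _; rewrite mulrDl; apply: integralD => //.
by rewrite mulrAC -[4%:Z%:~R]/(4%:R : L) divff // mul1r.
Qed.

(** The relation writes every power of v as c v + e with integral c and e, so 2 v^n is always
    integral and [integral_almost] applies. *)
Lemma integral_quadratic (v a r : L) : integral (2%:R * v) -> integral a -> integral r ->
  v ^+ 2 = a * v + r -> integral v.
Proof.
move=> i2v ia ir Dv; apply: (integral_almost two_neq0) => n.
have [c [e [ic ie ->]]] : exists c e, [/\ integral c, integral e & v ^+ n = c * v + e].
  elim: n => [|n [c [e [ic ie IH]]]].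
    exists 0, 1; rewrite mul0r add0r; split=> //; [exact: integral_0 | exact: integral_1].
  exists (c * a + e), (c * r); split; [|exact: integralM|].
    by apply: integralD => //; apply: integralM.
  have -> : v ^+ n.+1 = c * v ^+ 2 + e * v by rewrite exprSr IH; ring.
  by rewrite Dv; ring.
rewrite (_ : _ * _ = c * (2%:R * v) + 2%:R * e); last by ring.
by apply: integralD; apply: integralM => //; apply: integralN.
Qed.

Lemma dvdz2_cases (a : int) : (2 %| a)%Z \/ (2 %| a - 1)%Z.
Proof.
have [|/odd_dvdz[k ->]] := boolP (2 %| a)%Z; first by left.
by right; rewrite addrK dvdz_mulr.
Qed.

Lemma Euclid_dvdz2 (a c : int) : (2 %| a * c)%Z -> (2 %| a)%Z || (2 %| c)%Z.
Proof. by rewrite !dvdzE abszM Euclid_dvdM. Qed.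

Lemma quartic_disc : ~ (16 %| \det (igram b))%Z.
Proof.
move=> D16; have [sc [dd [sc_surj sc_dvd sc_tr [scD scZ dd_le prod_dd]]]] := smith_gram bI.
have [i0 [i1 [i2 [i3 [[v0 v1 v2 v3] ord4 Pdd]]]]] := four_ord dd d4.
have scB x y : integral x -> integral y -> sc (x - y) = sc x - sc y.
  move=> ix iy; rewrite -mulN1r -(rmorphN1 (intr : {rmorphism int -> L})) scD //.
    by rewrite scZ // scaleN1r.
  by apply: integralM iy; apply: integral_int.
have i1L := integral_1 L.
have nt1 : ~ trv 2 1 by move=> t1; apply: nA => y iy; rewrite -[y]mul1r; apply: t1.
have dd0 : ~~ (2 %| dd i0)%Z.
  apply/negP => d0; apply: nt1; apply/sc_tr => // i; apply: dvdz_mull.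
  by apply: dvdz_trans d0 (dd_le _ _ _); rewrite v0.
(* Otherwise [trv 2] depends only on the parity of the first coordinate. With w the first basis
   vector, 1 - w satisfies [trv 2]; as 1 has trace 4, the traces of w and w w are even, and then w
   itself satisfies [trv 2]. *)
have dd1 : ~~ (2 %| dd i1)%Z.
  apply/negP => d1.
  have ev y : integral y -> trv 2 y <-> (2 %| sc y 0%R i0)%Z.
    move=> iy; rewrite /trv sc_tr //; split=> [/(_ i0)/Euclid_dvdz2|e0 i].
      by rewrite (negPf dd0) orbF.
    have [->|ne0] := eqVneq i i0; first exact: dvdz_mulr.
    apply: dvdz_mull; apply: dvdz_trans d1 (dd_le _ _ _); rewrite v1 lt0n -v0.
    by rewrite val_eqE.
  have [w iw Dw] := sc_surj (delta_mx 0 i0).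
  have nev1 : ~~ (2 %| sc 1%R 0%R i0)%Z by apply/negP => /(ev 1 i1L).
  have i1w : integral (1 - w) by apply: integralB.
  have t1w : trv 2 (1 - w).
    apply/ev => //; rewrite scB // Dw !mxE !eqxx.
    by have [e|] := dvdz2_cases (sc 1 0 i0); [case/negP: nev1 |].
  have Tw : (2 %| itrace b w)%Z.
    have := trv_itrace t1w; have := itraceD bI iw i1w; rewrite addrC subrK itrace1 // d4.
    move=> E t; rewrite (_ : itrace b w = 4 - itrace b (1 - w)); last by rewrite [4]E addrK.
    by apply: rpredB.
  have Tww : (2 %| itrace b (w * w))%Z.
    have := t1w w iw; have := itraceD bI (integralM iw iw) (integralM i1w iw).
    rewrite -mulrDl addrC subrK mul1r => E t.
    rewrite (_ : itrace b (w * w) = itrace b w - itrace b ((1 - w) * w)); last by rewrite E addrK.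
    by apply: rpredB.
  have tw : trv 2 w.
    move=> z iz; rewrite mulrC; have [e|o] := dvdz2_cases (sc z 0 i0).
      by apply: (ev z iz).2.
    have izw : integral (z - w) by apply: integralB.
    have tzw : trv 2 (z - w) by apply/ev => //; rewrite scB // Dw !mxE !eqxx.
    rewrite -(subrK w z) mulrDl itraceD; [|done|exact: integralM|exact: integralM].
    by apply: rpredD => //; apply: tzw.
  by move/(ev w iw): tw; rewrite Dw mxE !eqxx.
have nE y i : trv 2 y -> integral y -> ~~ (2 %| dd i)%Z -> (2 %| sc y 0%R i)%Z.
  by move=> ty iy nd; have /Euclid_dvdz2 := (sc_tr 2 y iy).1 ty i; rewrite (negPf nd) orbF.
have D23 : (16 %| dd i2 * dd i3)%Z.
  have : (16 %| dd i0 * dd i1 * (dd i2 * dd i3))%Z.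
    by rewrite mulrA -Pdd dvdzE prod_dd -dvdzE.
  by rewrite Gauss_dvdzr // coprimezMr !(odd_coprimez 4).
(* When 4 divides the last two invariant factors, dropping the first two coordinates of u, which are
   even, gives a lift of u satisfying [trv 4]. *)
have [d42|nd42] := boolP (4 %| dd i2)%Z.
  have d43 : (4 %| dd i3)%Z by apply: dvdz_trans d42 (dd_le _ _ _); rewrite v2 v3.
  have [y iy Dy] := sc_surj (\row_i (if (4 %| dd i)%Z then sc u 0 i else 0)).
  apply: (no_trv4_lift iy); last first.
    apply/sc_tr => // i; rewrite Dy mxE; case: ifP => d; first exact: dvdz_mull.
    by rewrite mul0r dvdz0.
  apply/sc_dvd => //; first exact: integralB.
  move=> i; rewrite scB // Dy !mxE; case: ifP => nd; first by rewrite subrr dvdz0.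
  rewrite sub0r rpredN; apply: nE => //.
  by case/or4P: (ord4 i) nd => /eqP-> //; rewrite ?d42 ?d43.
have d83 : (8 %| dd i3)%Z.
  have [/dvdzP[k Dk]|o2] := boolP (2 %| dd i2)%Z; last first.
    apply: (@dvdz_trans 16) => //.
    by move: D23; rewrite Gauss_dvdzr // (odd_coprimez 4).
  have ok : ~~ (2 %| k)%Z.
    by apply: contra nd42; rewrite Dk => k2; rewrite (_ : 4 = 2 * 2) // dvdz_mul2r.
  move: D23; rewrite Dk (_ : k * 2 * dd i3 = 2 * (k * dd i3)); last by ring.
  by rewrite (_ : 16 = 2 * 8) // dvdz_mul2l //= Gauss_dvdzr // (odd_coprimez 3).
have [w iw Dw] := sc_surj (delta_mx 0 i3).
have t8w : trv 8 w.
  apply/sc_tr => // i; rewrite Dw mxE eqxx /=; case: eqP => [->|_]; first by rewrite mul1r.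
  by rewrite mul0r dvdz0.
have t4w : trv 4 w := trvW (isT : (4 %| 8)%Z) t8w.
have t2w : trv 2 w := trvW (isT : (2 %| 4)%Z) t4w.
have nw2 : ~ 2 %|* w by move/(sc_dvd 2 w isT iw)/(_ i3); rewrite Dw mxE !eqxx.
have icw (c : int) y : integral y -> integral (c%:~R * y).
  by apply: integralM; apply: integral_int.
have t4cw (c : int) : trv 4 (c%:~R * w) by rewrite mulrC; apply: trvM => //; apply: integral_int.
have ne3 j : j != i3 -> sc w 0 j = 0 by move=> /negPf ne; rewrite Dw mxE ne andbF.
have w3 : sc w 0 i3 = 1 by rewrite Dw mxE !eqxx.
have ne30 : i0 != i3 by rewrite -val_eqE /= v0 v3.
have ne31 : i1 != i3 by rewrite -val_eqE /= v1 v3.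
have ne32 : i2 != i3 by rewrite -val_eqE /= v2 v3.
have ou : (2 %| sc u 0%R i2 - 1)%Z.
  have [e|//] := dvdz2_cases (sc u 0 i2).
  have iz : integral ((sc u 0 i3)%:~R * w) by apply: icw.
  exfalso; apply: (no_trv4_lift iz _ (t4cw _)).
  apply/sc_dvd => //; first exact: integralB.
  move=> i; rewrite scB // scZ // !mxE.
  case/or4P: (ord4 i) => /eqP->; rewrite ?w3 ?ne3 // ?mulr1 ?subrr ?dvdz0 // mulr0 sub0r rpredN.
  - exact: nE.
  - exact: nE.
  - exact: e.
(* If the third coordinate of z were odd like that of u, z corrected by a multiple of w would be a
   forbidden lift of u. *)
have span4 z : integral z -> trv 4 z -> exists c : int, 2 %|* z - c%:~R * w.
  move=> iz t4z; have t2z : trv 2 z := trvW (isT : (2 %| 4)%Z) t4z.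
  have [e|o] := dvdz2_cases (sc z 0 i2).
    exists (sc z 0 i3); have iz3 := icw (sc z 0 i3) w iw.
    apply/sc_dvd => //; first exact: integralB.
    move=> i; rewrite scB // scZ // !mxE.
    case/or4P: (ord4 i) => /eqP->; rewrite ?w3 ?ne3 // ?mulr1 ?subrr ?dvdz0 // mulr0 subr0 //.
    - exact: nE.
    - exact: nE.
  pose c := sc z 0 i3 - sc u 0 i3; have ic : integral (c%:~R * w) by apply: icw.
  have iy : integral (z - c%:~R * w) by apply: integralB.
  exfalso; apply: (no_trv4_lift iy).
    apply/sc_dvd => //; first exact: integralB.
    move=> i; rewrite !scB // scZ // !mxE.
    case/or4P: (ord4 i) => /eqP->; rewrite ?w3 ?ne3 // ?mulr1 ?mulr0 ?subr0.
    - by apply: rpredB; apply: nE.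
    - by apply: rpredB; apply: nE.
    - by rewrite (_ : _ - _ = (sc z 0 i2 - 1) - (sc u 0 i2 - 1)); [apply: rpredB | ring].
    - by rewrite /c (_ : _ - _ = 0) ?dvdz0 //; ring.
  rewrite -mulNr -rmorphN; apply: trvD => //; [exact: icw | exact: t4cw].
have iww := integralM iw iw.
have t8ww : trv 8 (w * w) by apply: trvM.
have t4ww : trv 4 (w * w) := trvW (isT : (4 %| 8)%Z) t8ww.
have [c pc] := span4 _ iww t4ww.
(* Modulo 2, w^2 is 0 or w. In the first case w^2 / 2 satisfies [trv 4], so it is c' w modulo 2 and
   w / 2 is integral by its quadratic equation; in the second w^2 is idempotent modulo 4 with trace
   divisible by 4. *)
have [/dvdzP[k Dk]|/dvdzP[k Dk]] := dvdz2_cases c.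
  have iy : integral (w * w / 2%:R).
    rewrite (_ : _ / _ = (w * w - c%:~R * w) / 2%:R + k%:~R * w).
      by apply: integralD => //; apply: icw.
    by rewrite Dk intrM -[2%:~R]/(2%:R : L); field.
  have t4y : trv 4 (w * w / 2%:R).
    move=> z iz; have := t8ww z iz.
    rewrite (_ : w * w * z = 2%:Z%:~R * (w * w / 2%:R * z)).
      by rewrite itraceZ //; [rewrite (_ : 8 = 2 * 4) // dvdz_mul2l | apply: integralM].
    by rewrite -[2%:Z%:~R]/(2%:R : L); field.
  have [c' pc'] := span4 _ iy t4y.
  apply: nw2; apply: (@integral_quadratic _ c'%:~R ((w * w / 2%:R - c'%:~R * w) / 2%:R)) => //.
  - by rewrite mulrC divfK.
  - exact: integral_int.
  - by field.
have pw : 2 %|* w * w - w.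
  rewrite (_ : _ / _ = (w * w - c%:~R * w) / 2%:R + k%:~R * w).
    by apply: integralD => //; apply: icw.
  by rewrite -[c](subrK 1) Dk intrD intrM -[2%:~R]/(2%:R : L) -[1%:~R]/(1 : L); field.
apply: (@idempotent_trace (w * w)) => //.
- set r := (w * w - w) / 2%:R in pw.
  have Dww : w * w = w + 2%:R * r by rewrite /r; field.
  rewrite (_ : _ / _ = w * r + r ^+ 2).
    by apply: integralD; [apply: integralM | apply: integralX].
  by rewrite {1}Dww; rewrite (_ : (w + _) ^+ 2 - w * w = 4%:R * (w * r + r ^+ 2)); [field | ring].
- move=> pww; apply: nw2; rewrite (_ : w / _ = w * w / 2%:R - (w * w - w) / 2%:R); last by field.
  exact: integralB.
- exact: trvW (isT : (2 %| 4)%Z) t4ww.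
exact: trv_itrace.
Qed.

End Quartic.

Lemma propB_propA_quartic (L : fieldExtType rat) : nf_degree L = 4%N -> propB L -> propA L.
Proof.
move=> d4 /propB_component[p [b [P [h [p_pr pd [bI pD] [P_prime P_p] [ih hP Th _ [hinv _]]]]]]].
have p2 : p = 2.
  by move: pd;
    rewrite -/(nf_degree L) d4 -[4%N]/(2 ^ 2)%N Euclid_dvdX // andbT dvdn_prime2 // => /eqP.
subst p; apply: (propA_of_dvd bI p_pr); apply: Classical_Prop.NNPP => nA.
have [r ir hr] := hinv h ih hP.
(* The element v is idempotent modulo 2, and 3 v^2 - 2 v^3 lifts it to an idempotent modulo 4: u^2 -
   u is a multiple of (v - v^2)^2. *)
pose v := h * r; pose u := 3%:R * v ^+ 2 - 2%:R * v ^+ 3.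
have two_neq0 : (2%:R : L) != 0 := natL_neq0 L (n := 2) isT.
have four_neq0 : (4%:R : L) != 0 := natL_neq0 L (n := 4) isT.
have iv : integral v by apply: integralM.
have ivX n k : integral (n%:R * v ^+ k) by apply: integralM (integralN _ _) (integralX _ iv).
have v2 : integral ((v - v ^+ 2) / 2%:R).
  rewrite (_ : v - v ^+ 2 = r * (h * (1 - h * r))); last by rewrite /v; ring.
  exact: idvdM.
have iu : integral u by apply: integralB.
have tv : trv b 2 v by move=> z iz; rewrite -mulrA; apply: Th; apply: integralM.
apply: (@quartic_disc L b bI nA d4 u iu).
- rewrite (_ : _ / _ = ((v - v ^+ 2) / 2%:R) ^+ 2 * (4%:R * v ^+ 2 - 4%:R * v ^+ 1 - 3%:R * v
  ^+ 0)).
    by apply: integralM; [apply: integralX | apply: integralB => //; apply: integralB].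
  by rewrite /u; field; rewrite two_neq0 four_neq0.
- move=> u2; apply: hP; apply: (prime_idvd p_pr P_prime P_p).
  have v2' : integral (v / 2%:R).
    rewrite (_ : v / _ = u / 2%:R + (v - v ^+ 2) / 2%:R * (1%:R * v ^+ 0 - 2%:R * v ^+ 1)).
      by apply: integralD => //; apply: integralM => //; apply: integralB.
    by rewrite /u; field.
  rewrite (_ : h / _ = h * (v / 2%:R) + h * (1 - h * r) / 2%:R).
    by apply: integralD => //; apply: integralM.
  by rewrite /v; field.
- rewrite (_ : u = v * (3%:R * v ^+ 1 - 2%:R * v ^+ 2)); last by rewrite /u; ring.
  by apply: trvM => //; apply: integralB.
apply: dvdz_trans pD; rewrite -/(nf_degree L) d4; exact: dvdzz.
Qed.


(** * Normal fields *)

Definition alg_endomorphism (L : fieldExtType rat) (s : L -> L) :=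
  [/\ forall x y, s (x + y) = s x + s y, forall x y, s (x * y) = s x * s y, s 1 = 1
    & forall a x, s (a *: x) = a *: s x].

(** What the normal case needs from Galois theory, phrased with plain functions so that it transfers
    from the splitting field structure built in [normal_normed] back to [L]. *)
Definition normed_by_automorphisms (L : fieldExtType rat) :=
  exists (I : finType) (A : pred I) (s : I -> L -> L) (i0 : I),
  [/\ A i0, s i0 =1 id, forall i, alg_endomorphism (s i),
      forall i, exists j, forall x, s i (s j x) = x /\ s j (s i x) = x &
      forall a, exists q, \prod_(i | A i) s i a = q *: 1].

Lemma splitting_normed (L : splittingFieldType rat) : normed_by_automorphisms L.
Proof.
have gL : galois 1 {:L}.
  apply/and3P; split; first exact: sub1v.
    apply/separableP => x _; apply: pcharf0_separable => p.
    by rewrite (pchar_lalg L) pchar_num.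
  apply/normalFieldP => x _; have [rs /eqP ->] := splitting_field_normal 1%AS x.
  by exists rs => //; apply/allP => r _; apply: memvf.
exists (gal_of {:L}), (mem 'Gal({:L} / 1)%g), (fun (i : gal_of {:L}) x => i x), 1%g; split.
- exact: group1.
- by move=> x; rewrite gal_id.
- by move=> i; split=> [x y|x y||a x]; rewrite ?rmorphD ?rmorphM ?rmorph1 ?linearZ.
- move=> i; exists (i^-1)%g => x; rewrite -!galM ?memvf //.
  by rewrite mulgV mulVg gal_id.
move=> a; have := mem_galNorm gL (memvf a).
by case/vlineP=> q E; exists q.
Qed.

Lemma normal_normed (L : fieldExtType rat) : normal_over_Q L -> normed_by_automorphisms L.
Proof.
move=> nL; have ax : SplittingField.axiom L.
  apply: normal_field_splitting => K x; have [rs Drs] := nL x.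
  have := minPolyS x (sub1v K); rewrite Drs => /dvdp_prod_XsubC[m].
  rewrite eqp_monic ?monic_minPoly ?monic_prod_XsubC // => E.
  by exists (mask m rs).
pose spL := FieldExt_isSplittingField.Build rat L ax.
pose L' : splittingFieldType rat := HB.pack L spL.
exact: (splitting_normed L').
Qed.

Section Normal.
Variable L : fieldExtType rat.
Implicit Types (x y z : L).

Lemma integral_rational (q : rat) : integral (q *: (1 : L)) -> q \is a Num.int.
Proof.
case=> u [u_monic]; rewrite -[map_poly _ _]/(map_poly (intr : {rmorphism int -> L}) _).
rewrite (_ : map_poly _ u = map_poly (in_alg L) (map_poly intr u)); last first.
  by rewrite -map_poly_comp; apply: eq_map_poly => c /=; rewrite scaler_int.
rewrite -[q *: 1]/(in_alg L q) fmorph_root => qu.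
rewrite -Cint_rat; apply: Cint_rat_Aint; first exact: Crat_rat.
apply: (@root_monic_Aint (map_poly intr u)); last 2 first.
- exact: monic_map.
- by apply/polyOverP => i; rewrite coef_map intr_int.
rewrite (_ : map_poly _ u = map_poly (ratr : {rmorphism rat -> algC}) (map_poly intr u)).
  by rewrite fmorph_root.
by rewrite -map_poly_comp; apply: eq_map_poly => c /=; rewrite rmorph_int.
Qed.

Lemma automorphism_integral (s : L -> L) x :
  alg_endomorphism s -> integral x -> integral (s x).
Proof.
case=> sD sM s1 sZ [u [u_monic /rootP ux]]; exists u; split=> //; apply/rootP.
have s0 : s 0 = 0 by rewrite -[0 in LHS](scale0r 1) sZ scale0r.
rewrite -s0 -ux; elim/poly_ind: {u_monic ux} u => [|u c IH].
  by rewrite !rmorph0 !horner0 s0.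
rewrite -![map_poly _ _]/(map_poly (intr : {rmorphism int -> L}) _) in IH *.
rewrite !rmorphD !rmorphM /= !map_polyX !map_polyC /= !hornerE sD sM IH.
by congr (_ + _); rewrite intr_scale sZ s1.
Qed.

Lemma automorphism_trace (s : L -> L) x : alg_endomorphism s -> injective s ->
  nf_trace (s x) = nf_trace x.
Proof.
case=> sD sM s1 sZ s_inj; rewrite !nf_traceE.
pose S := \matrix_i coords (s (tnth (vbasis {:L}) i)).
have s0 : s 0 = 0 by rewrite -[0 in LHS](scale0r 1) sZ scale0r.
have sS y : coords (s y) = coords y *m S.
  rewrite {1}(coordsE y) mulmx_sum_row.
  rewrite (big_morph s sD s0); under eq_bigr => i _ do rewrite sZ.
  by rewrite coords_lin; apply: eq_bigr => i _; rewrite rowK.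
have coordsK (v : 'rV_(\dim {:L})) : exists y, v = coords y.
  by exists (\sum_i v 0 i *: tnth (vbasis {:L}) i); rewrite coords_sum.
have uS : S \in unitmx.
  rewrite -row_free_unit; apply: inj_row_free => v; have [y ->] := coordsK v.
  by rewrite -sS -(coords0 L) => /(@coords_inj L); rewrite -s0 => /s_inj ->; rewrite s0.
have E : mulmat x *m S = S *m mulmat (s x).
  apply/row_matrixP => i; rewrite !row_mul !rowK -sS sM -coordsM.
  by congr coords.
by rewrite -(mulKmx uS (mulmat (s x))) -E mxtrace_mulC mulmxK.
Qed.

Lemma normal_propC_propA : normal_over_Q L -> propC L -> propA L.
Proof.
move=> /normal_normed[I [A [s [i0 [Ai0 s_id s_aut s_inv s_norm]]]]].
case=> p [p_pr [P [e' [P_prime [Re' [e'_gt0 pe']]]]]].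
have P_p : P p%:R.
  have [pPe _] := Re'; have := ideal_pow_le P_prime e'_gt0 pPe.
  case=> t [tP ->]; rewrite big_seq; apply: (big_ind P); first exact: prime0.
    exact: primeD.
  by move=> v /tP [iv Pv]; apply: primeMr.
have [b bI] := integral_basis_exists L.
have [h [e [ih hP [e_gt0 Re] wT [_ _ hinv]]]] := prime_component bI p_pr P_prime P_p.
have Th : trv b p h by apply: wT; rewrite -(Re e').1.
have [r ir hr] := hinv h ih hP.
have i1L := integral_1 L.
have iq : integral (1 - h * r) by apply: integralB i1L (integralM ih ir).
have Pq : P (1 - h * r).
  by case: (prime_mul P_prime ih iq (prime_idvd p_pr P_prime P_p hr)).
have inj i : injective (s i).
  by have [j sK] := s_inv i; apply: (can_inj (g := s j)) => x; have [] := sK x.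
(* The trace of s(y) z equals that of y s^-1(z), so the ideal of the y with [trv b p y] is Galois
   stable. *)
have trs i y : integral y -> trv b p y -> trv b p (s i y).
  move=> iy Ty z iz; have [j sK] := s_inv i; have [_ sM _ _] := s_aut i.
  have isz : integral (s j z) by apply: automorphism_integral.
  have := Ty _ isz; suff -> : itrace b (y * s j z) = itrace b (s i y * z) by [].
  rewrite -[in RHS](sK z).1 -sM.
  have iyz : integral (y * s j z) by apply: integralM.
  apply: (@intr_inj rat); rewrite -(itraceE bI iyz).
  rewrite -(itraceE bI (automorphism_integral (s_aut i) iyz)).
  by rewrite (automorphism_trace _ (s_aut i) (inj i)).
have is_q i : integral (s i (1 - h * r)) by apply: automorphism_integral.
have s_unip i : trv b p (1 - s i (1 - h * r)).
  have [sD sM s1 sZ] := s_aut i.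
  have -> : 1 - s i (1 - h * r) = s i (h * r).
    by rewrite -{1}s1 -[X in s i X](subrK (h * r)) sD addrAC subrr add0r.
  by apply: trs; [apply: integralM | apply: trvM].
have [q Dq] := s_norm (1 - h * r).
have [iN T1N] : integral (q *: (1 : L)) /\ trv b p (1 - q *: 1).
  rewrite -Dq; apply: (big_ind (fun y => integral y /\ trv b p (1 - y))) => //.
  - by split=> // z iz; rewrite subrr mul0r -(mul0r z) -[0](scale0r 1);
       have := itraceZ bI 0 (integralM i1L iz); rewrite mul0r scale0r !mul0r => ->; rewrite dvdz0.
  - move=> x y [ix Tx] [iy Ty]; split; first exact: integralM.
    rewrite (_ : 1 - x * y = (1 - x) + (1 - y) * x); last by ring.
    by apply: trvD => //;
      [exact: integralB | apply: integralM => //; exact: integralB | exact: trvM].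
have PN : P (q *: 1).
  rewrite -Dq (bigD1 i0) //= s_id mulrC; apply: primeMr => //.
  apply: (big_ind (@integral L)) => //; exact: integralM.
have /intrP[m Dm] := integral_rational iN.
(* Both p and the norm m lie in [P]; were they coprime, a Bezout relation would put 1 there. *)
have pm : (p %| m)%Z.
  apply: contraT => npm; case: (prime1 P_prime).
  have /eqP cop : coprimez p m by rewrite coprimezE prime_coprime // -dvdzE.
  have [a [c ac]] := Bezoutz p m.
  have <- : a%:~R * p%:R + c%:~R * (q *: 1) = (1 : L).
    by rewrite Dm scaler_int -[p%:R]/(p%:Z%:~R) -!intrM -intrD ac cop.
  by apply: primeD => //; apply: primeMr => //; apply: integral_int.
apply: (propA_of_dvd bI p_pr) => y iy; rewrite -[y]mul1r.
suff : trv b p 1 by apply.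
rewrite -(subrK (q *: 1) 1); apply: trvD => //; first exact: integralB.
apply: (trv_nat bI (prime_gt0 p_pr)).
case/dvdzP: pm => k Dk; rewrite Dm Dk scaler_int intrM -[p%:Z%:~R]/(p%:R : L) mulfK.
  exact: integral_int.
exact: natL_neq0 (prime_gt0 p_pr).
Qed.
End Normal.

Theorem theorem2 (L : fieldExtType rat) :
  (propA L -> propB L) /\
  (propB L -> propC L) /\
  ((prime (nf_degree L) \/ nf_degree L = 4%N) -> propB L -> propA L) /\
  (normal_over_Q L -> propC L -> propA L).
Proof.
have [b bI] := integral_basis_exists L.
split; first exact: propA_propB bI.
split; first exact: propB_propC.
split; last exact: normal_propC_propA.
by case; [apply: propB_propA_prime | apply: propB_propA_quartic].
Qed.
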